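(* For every $m\in\mathbb{N}$, the $m$-OGP for the Ising $p$-spin glass model exhibits a sharp phase transition at $\gamma_{\mathrm{p-spin}}(m)=1/\sqrt{m}$, that is, \[ \sup\{\gamma>0:\gamma\text{ is }m\text{-admissible}\}=\frac{1}{\sqrt m}=\inf\{\gamma>0:\gamma\text{ is }m\text{-inadmissible}\}. \]
   Context: Let $\Sigma_n=\{-1,1\}^n$ and $\langle\sigma,\sigma'\rangle=\sum_{i\le n}\sigma(i)\sigma'(i)$. For an integer $p\ge 2$, let $\boldsymbol{J}=(J_{i_1,\dots,i_p}:1\le i_1,\dots,i_p\le n)$ have i.i.d. $\mathcal{N}(0,1)$ entries. The Ising $p$-spin Hamiltonian is \[ H(\sigma)=H_{n,p}(\sigma)=n^{-\frac{p+1}{2}}\sum_{1\le i_1,\dots,i_p\le n}J_{i_1,\dots,i_p}\,\sigma(i_1)\cdots\sigma(i_p),\qquad \sigma\in\Sigma_n . \] For $\gamma>0$, $m\in\mathbb{N}$ and $0<\eta<\xi<1$, $\mathcal{S}_{\mathrm{p-spin}}(\gamma,m,\xi,\eta)$ is the (random) set of all $m$-tuples $(\sigma^{(1)},\dots,\sigma^{(m)})\in\Sigma_n^m$ such that (i) $H(\sigma^{(t)})\ge\gamma\sqrt{2\ln 2}$ for all $1\le t\le m$, and (ii) $n^{-1}\langle\sigma^{(t)},\sigma^{(\ell)}\rangle\in[\xi-\eta,\xi]$ for all $1\le t<\ell\le m$. Fix $m\in\mathbb{N}$. A value $\gamma>0$ is called $m$-admissible if for every $0<\eta<\xi<1$ there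 exists $P^*(m,\gamma,\eta,\xi)\in\mathbb{N}$ such that for every fixed $p\ge P^*(m,\gamma,\eta,\xi)$, $\lim_{n\to\infty}\mathbb{P}[\mathcal{S}_{\mathrm{p-spin}}(\gamma,m,\xi,\eta)\ne\varnothing]=1$. A value $\gamma>0$ is called $m$-inadmissible if there exist $0<\eta<\xi<1$ and $\hat P\in\mathbb{N}$ such that for every fixed $p\ge\hat P$, $\lim_{n\to\infty}\mathbb{P}[\mathcal{S}_{\mathrm{p-spin}}(\gamma,m,\xi,\eta)\ne\varnothing]=0$. *)

(* Defs.v *)
From HB Require Import structures.
From mathcomp Require Import all_boot all_order all_algebra.
From mathcomp Require Import all_classical all_reals all_analysis.

Set Implicit Arguments.
Unset Strict Implicit.
Unset Printing Implicit Defensive.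

Import Order.TTheory GRing.Theory Num.Theory.
Import numFieldNormedType.Exports.

Local Open Scope classical_set_scope.
Local Open Scope ring_scope.

(* [Sigma n] encodes the hypercube {-1, 1}^n by bits: a bit [b] stands for the
   spin (-1)^b, so [false] is +1 and [true] is -1. *)
Definition Sigma (n : nat) : Type := {ffun 'I_n -> bool}.

Definition spin (R : realType) (n : nat) (s : Sigma n) (i : 'I_n) : R :=
  (-1) ^+ s i.

Definition overlap (R : realType) (n : nat) (s s' : Sigma n) : R :=
  \sum_(i < n) spin R s i * spin R s' i.

(* An index (i_1, ..., i_p) in {1, ..., n}^p is a finite function
   ['I_p -> 'I_n]; coordinates may repeat and no symmetry is imposed on [J]. *)
Definition hamiltonian (R : realType) (n p : nat)
    (J : {ffun 'I_p -> 'I_n} -> R) (s : Sigma n) : R :=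
  n%:R `^ (- (p.+1%:R / 2)) *
  \sum_(i : {ffun 'I_p -> 'I_n}) J i * \prod_(k < p) spin R s (i k).

Definition S_pspin (R : realType) (n p : nat) (J : {ffun 'I_p -> 'I_n} -> R)
    (gamma : R) (m : nat) (xi eta : R) : set ('I_m -> Sigma n) :=
  [set s | (forall t : 'I_m,
              gamma * Num.sqrt (2 * ln 2) <= hamiltonian J (s t)) /\
           (forall t l : 'I_m, (t < l)%N ->
              xi - eta <= n%:R^-1 * overlap R (s t) (s l) <= xi)].
Arguments S_pspin {R n p} J gamma m xi eta.

Definition mutually_independent d (T : measurableType d) (R : realType)
    (P : probability T R) (I : finType) (X : I -> {RV P >-> R}) : Prop :=
  forall (B : {set I}) (A : I -> set R),
    (forall i, measurable (A i)) ->
    P (\bigcap_(i in [set` B]) (X i @^-1` A i)) =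
    (\prod_(i in B) P (X i @^-1` A i))%E.

(* The two laws are compared on Borel sets only: their values, as functions of
   arbitrary sets, carry no meaning elsewhere. *)
Definition standard_gaussian d (T : measurableType d) (R : realType)
    (P : probability T R) (X : {RV P >-> R}) : Prop :=
  forall A : set R, measurable A -> distribution P X A = normal_prob 0 1 A.

Definition iid_standard_gaussian d (T : measurableType d) (R : realType)
    (P : probability T R) (I : finType) (X : I -> {RV P >-> R}) : Prop :=
  mutually_independent X /\ forall i, standard_gaussian (X i).

(* For each size [n] and each order [p] the disorder lives on its own
   probability space: only its law for fixed [n] and [p] matters, and no
   coupling between different values of [n] or [p] is assumed. *)
Section admissibility.
Context (R : realType) (d : nat -> nat -> measure_display)
  (T : forall n p, measurableType (d n p))
  (P : forall n p, probability (T n p) R)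
  (J : forall n p, {ffun 'I_p -> 'I_n} -> {RV (P n p) >-> R}).

Definition prob_nonempty (gamma : R) (m : nat) (xi eta : R) (p n : nat)
    : \bar R :=
  P n p [set w | S_pspin (fun i => J i w) gamma m xi eta !=set0].

Definition admissible (m : nat) (gamma : R) : Prop :=
  forall xi eta : R, 0 < eta -> eta < xi -> xi < 1 ->
  exists Pstar : nat, forall p : nat, (2 <= p)%N -> (Pstar <= p)%N ->
    prob_nonempty gamma m xi eta p n @[n --> \oo] --> 1%E.

Definition inadmissible (m : nat) (gamma : R) : Prop :=
  exists xi eta : R, [/\ 0 < eta, eta < xi & xi < 1] /\
  exists Phat : nat, forall p : nat, (2 <= p)%N -> (Phat <= p)%N ->
    prob_nonempty gamma m xi eta p n @[n --> \oo] --> 0%E.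

End admissibility.

(* Main.v *)
Require Import Defs.
From HB Require Import structures.
From mathcomp Require Import all_boot all_order all_algebra.
From mathcomp Require Import all_classical all_reals all_analysis measurable_realfun.
From mathcomp Require Import finmap ring lra.

Set Implicit Arguments.
Unset Strict Implicit.
Unset Printing Implicit Defensive.

Import Order.TTheory GRing.Theory Num.Theory.
Import numFieldNormedType.Exports.

Local Open Scope classical_set_scope.
Local Open Scope ring_scope.

(** Everything about the disorder enters through
      E exp(n sum_t c_t H(s_t)) = exp((n/2) sum_{t,l} c_t c_l (<s_t, s_l>/n)^p).

    Above the threshold, take overlaps between 1 - eps/2 and 1 - eps/4: at most
    2^n e^{o(n)} tuples have them (as eps -> 0), while for large p the
    correlations xi^p are negligible, so that a Chernoff bound on sum_t H(s_t)
    gives each tuple probability about 2^{-n m gamma^2}.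

    Below the threshold, fix masks a_1, ..., a_m with pairwise overlaps in
    [xi - eta, xi] and use only the 2^n tuples (a_1 s, ..., a_m s).  A second
    moment argument is run on Z = sum_s exp(n lam sum_t H(a_t s)) restricted to
    those s for which every H(a_t s) is within dl of
    lam = gamma sqrt(2 ln 2) + dl.  Pairs (s, s') whose cross overlaps all stay
    below 1 - eps contribute the square of the mean up to 1 + o(1), since
    |r|^p is dominated by the entropy r^2; for the e^{o(n)} 2^n remaining pairs
    the truncation bounds the second factor of the product, which costs less
    than 2^n because m gamma^2 < 1.  Both truncations are replaced by
    exponential upper bounds, so only the formula above is needed. *)

(** * Exponential moments of independent Gaussians *)

Import HBNNSimple.

(** Monotone convergence along the simple functions [g n]: the integral depends on [W], [X] and [mu]
    only through the integrals of [W] against indicators of events in [X]. *)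
Lemma ge0_integral_weight_lim d1 d2 (T1 : measurableType d1)
    (T2 : measurableType d2) (R : realType) (mu : {measure set T1 -> \bar R})
    (W : T1 -> R) (X : T1 -> T2) (f : T2 -> \bar R) (g : {nnsfun T2 >-> R}^nat) :
  measurable_fun setT W -> (forall x, 0 <= W x) ->
  measurable_fun setT X ->
  nondecreasing_seq (fun n => g n : T2 -> R) ->
  (forall y, (g n y)%:E @[n --> \oo] --> f y) ->
  (\int[mu]_x ((W x)%:E * f (X x)) =
   limn (fun n => \sum_(y \in range (g n))
     y%:E * \int[mu]_x (W x * \1_(g n @^-1` [set y]) (X x))%:E))%E.
Proof.
move=> mW W0 mX ndg gf.
have mWg n : measurable_fun setT (fun x => W x * g n (X x)).
  by apply: measurable_funM => //; exact: measurableT_comp.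
transitivity (limn (fun n => \int[mu]_x (W x * g n (X x))%:E))%E.
  rewrite -monotone_convergence //.
  - apply: eq_integral => x _; apply/esym/cvg_lim => //.
    under eq_fun do rewrite EFinM.
    by apply: cvgeZl => //; exact: gf.
  - by move=> n; exact/measurable_EFinP.
  - by move=> n x _; rewrite lee_fin mulr_ge0.
  - move=> x _ m n mn; rewrite lee_fin ler_wpM2l //.
    exact/lefP/ndg.
congr (limn _); apply/funext => n.
have finr : finite_set (range (g n)) by [].
have mW1 y : measurable_fun setT
    (fun x => (W x * \1_(g n @^-1` [set y]) (X x))%:E).
  apply/measurable_EFinP/measurable_funM => //.
  apply: (measurableT_comp _ mX); apply: measurable_indic.
  exact: measurable_funPTI.
rewrite fsbig_finite //=.
have y0 y : y \in fset_set (range (g n)) -> 0 <= y.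
  by rewrite in_fset_set // => /set_mem [t _ <-]; exact: fun_ge0.
transitivity (\int[mu]_x \sum_(y <- fset_set (range (g n)))
    (`|y| * (W x * \1_(g n @^-1` [set y]) (X x)))%:E)%E.
  apply: eq_integral => x _; rewrite sumEFin; congr EFin.
  rewrite fimfunE fsbig_finite //= mulr_sumr !big_seq.
  by apply: eq_bigr => y /y0 y_ge0; rewrite ger0_norm // mulrCA.
rewrite ge0_integral_sum //.
- rewrite !big_seq; apply: eq_bigr => y /y0 y_ge0.
  under eq_integral do rewrite EFinM.
  rewrite ge0_integralZl_EFin ?ger0_norm //.
  by move=> x _; rewrite lee_fin mulr_ge0.
- move=> y; under eq_fun do rewrite EFinM.
  by apply: measurable_funeM; exact: mW1.
- by move=> y x _; rewrite lee_fin !mulr_ge0.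
Qed.

(* The hypothesis on indicators says that the images of [W1 mu1] under [X1] and
   of [W2 mu2] under [X2] coincide. *)
Lemma ge0_integral_weight_eq d1 d2 d3 (T1 : measurableType d1)
    (T2 : measurableType d2) (T3 : measurableType d3) (R : realType)
    (mu1 : {measure set T1 -> \bar R}) (mu2 : {measure set T2 -> \bar R})
    (W1 : T1 -> R) (X1 : T1 -> T3) (W2 : T2 -> R) (X2 : T2 -> T3)
    (f : T3 -> \bar R) :
  measurable_fun setT W1 -> (forall x, 0 <= W1 x) -> measurable_fun setT X1 ->
  measurable_fun setT W2 -> (forall x, 0 <= W2 x) -> measurable_fun setT X2 ->
  (forall A, measurable A ->
    \int[mu1]_x (W1 x * \1_A (X1 x))%:E = \int[mu2]_x (W2 x * \1_A (X2 x))%:E)%E ->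
  measurable_fun setT f -> (forall x, 0 <= f x)%E ->
  (\int[mu1]_x ((W1 x)%:E * f (X1 x)) = \int[mu2]_x ((W2 x)%:E * f (X2 x)))%E.
Proof.
move=> mW1 W10 mX1 mW2 W20 mX2 W12 mf f0.
pose g := nnsfun_approx measurableT mf.
have gf y : (g n y)%:E @[n --> \oo] --> f y by exact: cvg_nnsfun_approx.
have ndg : nondecreasing_seq (fun n => g n : T3 -> R) by exact: nd_nnsfun_approx.
rewrite (ge0_integral_weight_lim mu1 mW1 W10 mX1 ndg gf).
rewrite (ge0_integral_weight_lim mu2 mW2 W20 mX2 ndg gf).
congr (limn _); apply/funext => n; apply: eq_fsbigr => y _.
by rewrite W12 //; exact: measurable_funPTI.
Qed.

(** Completing the square turns the tilted standard density into exp(a^2 / 2) times the density of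
    mean [a]. *)
Lemma integral_expR_normal_pdf (R : realType) (a : R) :
  (\int[lebesgue_measure]_x (normal_pdf 0 1 x * expR (a * x))%:E
   = (expR (a ^+ 2 / 2))%:E)%E.
Proof.
have E x : normal_pdf 0 1 x * expR (a * x)
    = expR (a ^+ 2 / 2) * normal_pdf a 1 x :> R.
  rewrite !normal_pdfE ?oner_eq0 // /normal_fun -mulrA -expRD mulrCA -expRD.
  by congr (_ * expR _); field.
under eq_integral do rewrite E EFinM.
rewrite ge0_integralZl_EFin ?expR_ge0 //; first last.
- by apply/measurable_EFinP; exact: measurable_normal_pdf.
- by move=> x _; rewrite lee_fin normal_pdf_ge0.
by rewrite integral_normal_pdf ?oner_eq0 // mule1.
Qed.

(** The indicators are carried along so that induction on [s] closes: integrating out exp(c_j X_j)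
    requires the law of [X j] under the measure weighted by the other factors, and a law is tested
    on indicators. Independence is the base case. *)
Lemma expectation_prod_expR_indic d (T : measurableType d) (R : realType)
    (P : probability T R) (I : finType) (X : I -> {RV P >-> R}) (c : I -> R)
    (s : seq I) :
  iid_standard_gaussian X -> uniq s -> forall A : I -> set R,
  (forall i, measurable (A i)) -> (forall i, i \in s -> A i = setT) ->
  (\int[P]_w (\prod_(i <- s) expR (c i * X i w) * \prod_i \1_(A i) (X i w))%:E =
   (\prod_(i <- s) expR (c i ^+ 2 / 2) * \prod_i fine (P (X i @^-1` A i)))%:E)%E.
Proof.
move=> [indX gaussX].
have mXA i B : measurable B -> measurable (X i @^-1` B).
  by move=> mB; exact: measurable_funPTI.
elim: s => [_ A mA _|j s IH /= /andP[js us] A mA As].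
  set S := \bigcap_(i in [set` [set: I]%SET]) (X i @^-1` A i).
  have mS : measurable S.
    by apply: fin_bigcap_measurable => // i _; exact: mXA.
  have SE w : \prod_i (\1_(A i) (X i w) : R) = \1_S w.
    rewrite [RHS]indicE; have [wS|wS] := boolP (w \in S).
      apply: big1 => i _; rewrite indicE mem_set //.
      by move/set_mem : wS => /(_ i); apply; rewrite /= inE.
    have [i wi] : exists i, ~ A i (X i w).
      apply/existsNP => h; move/negP : wS; apply; apply/mem_set => i _.
      exact: h.
    by rewrite (bigD1 i) //= indicE memNset // mul0r.
  under eq_integral do rewrite big_nil mul1r SE.
  rewrite big_nil mul1r integral_indic // setIT.
  apply: (etrans (indX [set: I]%SET A mA)).
  rewrite -prodEFin; apply: eq_big => [i|i _]; first by rewrite inE.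
  by rewrite fineK // fin_num_measure //; exact: mXA.
pose W w := \prod_(i <- s) expR (c i * X i w) * \prod_i (\1_(A i) (X i w) : R).
pose k := \prod_(i <- s) expR (c i ^+ 2 / 2)
  * \prod_(i | i != j) fine (P (X i @^-1` A i)).
have k0 : 0 <= k.
  apply: mulr_ge0; apply: prodr_ge0 => i _; first exact: expR_ge0.
  exact: fine_ge0.
have mW : measurable_fun setT W.
  apply: measurable_funM; apply: measurable_prod => i _.
    apply: measurableT_comp; first exact: measurable_expR.
    exact: measurable_funM.
  have mI : measurable_fun setT (\1_(A i) : R -> R) by exact: measurable_indic.
  exact: (measurableT_comp mI).
have W0 w : 0 <= W w.
  by apply: mulr_ge0; apply: prodr_ge0 => i _; rewrite ?expR_ge0 // indicE.
have mk : measurable_fun setT (fun x : R => k * normal_pdf 0 1 x).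
  by apply: measurable_funM => //; exact: measurable_normal_pdf.
have Aj : A j = setT by apply: As; rewrite mem_head.
(* Under [P] weighted by [W], the variable [X j] has [k] times the Gaussian density; this is checked
   on each [B] below. *)
have key := @ge0_integral_weight_eq _ _ _ _ _ _ R P lebesgue_measure W (X j)
  (fun x => k * normal_pdf 0 1 x) idfun (fun x => (expR (c j * x))%:E)
  mW W0 _ mk.
under eq_integral => w _.
  rewrite big_cons -mulrA mulrC EFinM -/(W w).
over.
rewrite key => //.
- under eq_integral do rewrite -EFinM -mulrA EFinM.
  rewrite ge0_integralZl_EFin //; first last.
  + apply/measurable_EFinP/measurable_funM; first exact: measurable_normal_pdf.
    apply: measurableT_comp; first exact: measurable_expR.
    exact: mulrl_measurable.
  + by move=> x _; rewrite lee_fin mulr_ge0 ?normal_pdf_ge0 ?expR_ge0.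
  rewrite integral_expR_normal_pdf -EFinM /k; congr EFin.
  rewrite big_cons [in RHS](bigD1 j) //= Aj preimage_setT probability_setT mul1r.
  by rewrite mulrC mulrA.
- by move=> x; rewrite mulr_ge0 ?normal_pdf_ge0.
- exact: measurable_id.
- move=> B mB.
  (* As [A j] is the whole line, the event that [X j] lies in [B] is absorbed by putting [B] at [j];
     since [j] is not in [s], [IH] applies to [A']. *)
  pose A' i := if i == j then B else A i.
  have WE w : W w * \1_B (X j w) = \prod_(i <- s) expR (c i * X i w)
      * \prod_i (\1_(A' i) (X i w) : R).
    rewrite /W -mulrA; congr (_ * _).
    rewrite (bigD1 j) //= Aj indicT mul1r mulrC [RHS](bigD1 j) //= /A' eqxx.
    by congr (_ * _); apply: eq_bigr => i /negbTE ->.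
  under eq_integral do rewrite WE.
  rewrite IH //; first last.
  + move=> i is_; rewrite /A'; case: eqP => [ij|_]; last first.
      by apply: As; rewrite inE is_ orbT.
    by move: js; rewrite -ij is_.
  + by move=> i; rewrite /A'; case: ifP.
  under [RHS]eq_integral do rewrite -mulrA EFinM.
  rewrite ge0_integralZl_EFin //; first last.
  + apply/measurable_EFinP/measurable_funM; first exact: measurable_normal_pdf.
    exact: measurable_indic.
  + by move=> x _; rewrite lee_fin mulr_ge0 ?normal_pdf_ge0.
  have -> : (\int[lebesgue_measure]_x (normal_pdf 0 1 x * \1_B x)%:E
             = P (X j @^-1` B))%E.
    rewrite -[RHS]/(distribution P (X j) B) gaussX // /normal_prob.
    rewrite [RHS]integral_mkcond; apply: eq_integral => x _.
    by rewrite restrict_EFin patch_indic.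
  rewrite -[P _]fineK ?fin_num_measure //; last exact: mXA.
  rewrite -EFinM /k; congr EFin; rewrite -mulrA; congr (_ * _).
  rewrite (bigD1 j) //= /A' eqxx mulrC; congr (_ * _).
  by apply: eq_bigr => i /negbTE ->.
- apply/measurable_EFinP; apply: measurableT_comp; first exact: measurable_expR.
  exact: mulrl_measurable.
Qed.

Lemma expectation_expR_lin d (T : measurableType d) (R : realType)
    (P : probability T R) (I : finType) (X : I -> {RV P >-> R}) (c : I -> R) :
  iid_standard_gaussian X ->
  (\int[P]_w (expR (\sum_i c i * X i w))%:E
   = (expR (\sum_i c i ^+ 2 / 2))%:E)%E.
Proof.
move=> iidX; rewrite !expR_sum -[X in _ = X%:E]mulr1.
have := expectation_prod_expR_indic c iidX (index_enum_uniq I)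
  (A := fun=> setT) (fun=> measurableT) (fun _ _ => erefl).
rewrite [X in (_ * X)%:E]big1; last first.
  by move=> i _; rewrite preimage_setT probability_setT.
move <-; apply: eq_integral => w _; rewrite expR_sum.
by rewrite [X in _ * X]big1 ?mulr1 // => i _; rewrite indicT.
Qed.

(** * Exponential moments of the Hamiltonian *)

(** The inner product of two p-th tensor powers is the p-th power of the inner product. *)
Lemma sum_tensor_mul (R : realType) (n p : nat) (s t : Sigma n) :
  \sum_(i : {ffun 'I_p -> 'I_n})
    (\prod_(k < p) spin R s (i k)) * (\prod_(k < p) spin R t (i k))
  = overlap R s t ^+ p.
Proof.
under eq_bigr do rewrite -big_split /=.
rewrite -(bigA_distr_bigA (fun (k : 'I_p) j => spin R s j * spin R t j)) /=.
by rewrite prodr_const card_ord.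
Qed.

(** Multiplied by the overlap to the power [p], this is the covariance of n H(s) and n H(t), namely
    n (<s, t> / n)^p. *)
Lemma powR_scale (R : realType) (n p : nat) : (0 < n)%N ->
  (n%:R * n%:R `^ (- (p.+1%:R / 2))) ^+ 2 = n%:R / n%:R ^+ p :> R.
Proof.
move=> n0; have n0R : n%:R != 0 :> R by rewrite pnatr_eq0 -lt0n.
rewrite exprMn -(powR_mulrn 2 (powR_ge0 _ _)) -powRrM.
rewrite (_ : - (p.+1%:R / 2) * 2 = - p.+1%:R :> R); last by field.
by rewrite powRN powR_mulrn ?ler0n // (exprS _ p); field; rewrite n0R expf_neq0.
Qed.

Lemma expectation_expR_hamiltonian (R : realType) d (T : measurableType d)
    (P : probability T R) (n p : nat) (X : {ffun 'I_p -> 'I_n} -> {RV P >-> R})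
    (K : finType) (s : K -> Sigma n) (th : K -> R) :
  iid_standard_gaussian X -> (0 < n)%N ->
  (\int[P]_w (expR (n%:R * \sum_t th t * hamiltonian (X ^~ w) (s t)))%:E
   = (expR (n%:R / 2 * \sum_t \sum_l th t * th l
        * (n%:R^-1 * overlap R (s t) (s l)) ^+ p))%:E)%E.
Proof.
move=> iidX n0.
pose a : R := n%:R * n%:R `^ (- (p.+1%:R / 2)).
pose c (i : {ffun 'I_p -> 'I_n}) := a * \sum_t th t * \prod_(k < p) spin R (s t) (i k).
transitivity (\int[P]_w (expR (\sum_i c i * X i w))%:E)%E.
  apply: eq_integral => w _; congr (expR _)%:E.
  rewrite /hamiltonian mulr_sumr.
  under [RHS]eq_bigr do rewrite /c mulr_sumr mulr_suml.
  rewrite exchange_big /=; apply: eq_bigr => t _.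
  rewrite !mulrA mulr_sumr; apply: eq_bigr => i _; rewrite /a; ring.
rewrite expectation_expR_lin //; congr (expR _)%:E.
have E i : c i ^+ 2 / 2 = a ^+ 2 / 2 * \sum_t \sum_l th t * th l *
    ((\prod_(k < p) spin R (s t) (i k)) * \prod_(k < p) spin R (s l) (i k)).
  rewrite /c exprMn -mulrAC; congr (_ * _).
  rewrite expr2 mulr_suml; apply: eq_bigr => t _.
  by rewrite mulr_sumr; apply: eq_bigr => l _; ring.
under eq_bigr do rewrite E.
rewrite -mulr_sumr exchange_big /=.
under eq_bigr do rewrite exchange_big /=.
under eq_bigr do under eq_bigr do rewrite -mulr_sumr sum_tensor_mul.
rewrite powR_scale // !mulr_sumr; apply: eq_bigr => t _.
rewrite !mulr_sumr; apply: eq_bigr => l _.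
by rewrite exprMn exprVn; ring.
Qed.

Lemma measurable_hamiltonian (R : realType) d (T : measurableType d)
    (P : probability T R) (n p : nat) (X : {ffun 'I_p -> 'I_n} -> {RV P >-> R})
    (s : Sigma n) :
  measurable_fun setT (fun w => hamiltonian (X ^~ w) s).
Proof.
apply: measurable_funM => //; apply: measurable_sum => i.
exact: measurable_funM.
Qed.

(** The exponential factorises over coordinates, and as [t] varies each coordinate contributes both
    signs once, whatever [s] and [a] are. *)
Lemma sum_expR_overlap (R : realType) (n : nat) (s a : Sigma n) (th : R) :
  \sum_(t : {ffun 'I_n -> bool})
      expR (th * overlap R s ([ffun i => a i (+) t i] : Sigma n))
  = (expR th + expR (- th)) ^+ n.
Proof.
transitivity (\sum_(t : {ffun 'I_n -> bool}) \prod_(i < n)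
    expR (th * (spin R s i * (-1) ^+ (a i (+) t i)))).
  apply: eq_bigr => t _; rewrite /overlap mulr_sumr expR_sum.
  by apply: eq_bigr => i _; rewrite /spin ffunE.
rewrite -(bigA_distr_bigA (fun i (b : bool) =>
  expR (th * (spin R s i * (-1) ^+ (a i (+) b))))) /=.
rewrite (eq_bigr (fun=> expR th + expR (- th))) ?prodr_const ?card_ord // => i _.
rewrite big_bool /spin; case: (s i); case: (a i);
  rewrite /= ?expr1 ?expr0 ?mulN1r ?mul1r ?mulrN1 ?opprK ?mulr1 //; by rewrite addrC.
Qed.

(** * Overlaps on the hypercube *)

Lemma expR_le_inv1B (R : realType) (x : R) : x < 1 -> expR x <= (1 - x)^-1.
Proof.
move=> x1; rewrite -[x in leLHS]opprK expRN lef_pV2 ?posrE ?expR_gt0 ?subr_gt0 //.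
exact: expR_ge1Dx.
Qed.

(** A bound on 2 cosh(x), from exp(x) <= 1 / (1 - x) at [x] and [- x], then 1 / (1 - x^2) <= 1 + 2
    x^2. *)
Lemma expR_addN_le (R : realType) (x : R) : x ^+ 2 <= 1 / 2 ->
  expR x + expR (- x) <= 2 * expR (2 * x ^+ 2).
Proof.
move=> x2.
have x1 : x < 1 by nra.
have Nx1 : - x < 1 by nra.
apply: le_trans (lerD (expR_le_inv1B x1) (expR_le_inv1B Nx1)) _.
have d0 : 0 < 1 - x ^+ 2 by lra.
have -> : (1 - x)^-1 + (1 - - x)^-1 = 2 * (1 - x ^+ 2)^-1.
  by field; rewrite -?[1 - x ^+ 2]/(_); apply/and3P; split; apply/eqP => h; nra.
rewrite ler_pM2l //; apply: le_trans (expR_ge1Dx _).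
by rewrite -div1r ler_pdivrMr //; nra.
Qed.

Definition hamming_dist n (s t : Sigma n) : nat :=
  #|[pred i | s i != t i]|.

Lemma overlapE (R : realType) n (s t : Sigma n) :
  overlap R s t = n%:R - 2 * (hamming_dist s t)%:R.
Proof.
have E (i : 'I_n) : spin R s i * spin R t i = 1 - 2 * (s i != t i)%:R :> R.
  by rewrite /spin; case: (s i); case: (t i); rewrite /= ?expr1 ?expr0; lra.
rewrite /overlap; under eq_bigr do rewrite E.
rewrite big_split /=.
rewrite sumr_const card_ord sumrN -mulr_sumr -natr_sum; congr (_ - _ * _%:R).
rewrite /hamming_dist -sum1_card [RHS]big_mkcond.
by apply: eq_bigr => i _; rewrite inE; case: eqP.
Qed.

Lemma hamming_dist_le n (s t : Sigma n) : (hamming_dist s t <= n)%N.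
Proof. by rewrite -[leqRHS]card_ord max_card. Qed.

(** Typical overlaps are of order the square root of [n], so this average over the hypercube grows
    only polynomially. Far pairs are measured against it. *)
Lemma sum_expR_overlap_sqr (R : realType) n (s a : Sigma n) : (0 < n)%N ->
  \sum_(t : {ffun 'I_n -> bool})
      expR (overlap R s ([ffun i => a i (+) t i] : Sigma n) ^+ 2 / (8 * n%:R))
  <= 2 ^+ n * n.+1%:R :> R.
Proof.
move=> n0; have n0R : 0 < n%:R :> R by rewrite ltr0n.
pose k (h : 'I_n.+1) : R := n%:R - 2 * h%:R.
pose b (t : {ffun 'I_n -> bool}) : Sigma n := [ffun i => a i (+) t i].
(* The overlap takes n + 1 values [k h]; at each of them the tangent
   [(k h / 4n) x - (k h)^2 / 8n] attains the parabola [x^2 / 8n]. *)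
apply: (@le_trans _ _ (\sum_t \sum_h
    expR (k h / (4 * n%:R) * overlap R s (b t)) / expR (k h ^+ 2 / (8 * n%:R)))).
  apply: ler_sum => t _.
  have hn : (hamming_dist s (b t) < n.+1)%N by rewrite ltnS hamming_dist_le.
  rewrite (bigD1 (Ordinal hn)) //= -[leLHS]addr0 lerD //; last first.
    by apply: sumr_ge0 => h _; rewrite divr_ge0 ?expR_ge0.
  rewrite -expRN -expRD ler_expR {1}/k /= -overlapE.
  by rewrite le_eqVlt; apply/orP; left; apply/eqP; rewrite /k /= -overlapE; field; lra.
rewrite exchange_big /=.
apply: (@le_trans _ _ (\sum_(h < n.+1) 2 ^+ n)); last first.
  by rewrite sumr_const card_ord mulr_natr.
apply: ler_sum => h _; rewrite -mulr_suml sum_expR_overlap.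
rewrite ler_pdivrMr ?expR_gt0 //.
have kh : k h ^+ 2 <= n%:R ^+ 2.
  have : h%:R <= n%:R :> R by rewrite ler_nat -ltnS.
  have : 0 <= h%:R :> R by [].
  by rewrite /k => *; nra.
have khn : k h ^+ 2 / n%:R ^+ 2 <= 1 by rewrite ler_pdivrMr ?exprn_gt0 // mul1r.
(* At slope th = k h / 4n the bound 2^n exp(2 n th^2) equals 2^n exp((k h)^2 / 8n), which cancels
   the constant term of the tangent. *)
have E : (k h / (4 * n%:R)) ^+ 2 = k h ^+ 2 / n%:R ^+ 2 / 16 by field; lra.
apply: le_trans (lerXn2r n _ _ (expR_addN_le _)) _.
- by rewrite nnegrE addr_ge0 ?expR_ge0.
- by rewrite nnegrE mulr_ge0 ?expR_ge0.
- by rewrite E; lra.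
rewrite exprMn -expRM_natl E ler_pM2l ?exprn_gt0 // ler_expR.
by rewrite le_eqVlt; apply/orP; left; apply/eqP; field; lra.
Qed.

(** The left side is the Chernoff base for counting configurations at overlap at least n (1 - eps)
    with a given one. It equals exp(th eps) (1 + exp(-2 th)); for th = 1 / kappa and eps <= kappa^2
    / 2 both factors are at most exp(kappa / 2). *)
Lemma near_count_exponent (R : realType) (kappa : R) : 0 < kappa ->
  exists th eps : R, [/\ 0 < th, 0 < eps, eps < 1 &
    (expR th + expR (- th)) * expR (- (th * (1 - eps))) <= expR kappa].
Proof.
move=> k0; pose th := kappa^-1; pose eps := Num.min (1 / 2) (kappa ^+ 2 / 2).
have th0 : 0 < th by rewrite invr_gt0.
have eps0 : 0 < eps by rewrite lt_min; apply/andP; split; nra.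
exists th, eps; split => //; first by rewrite gt_min; apply/orP; left; lra.
rewrite mulrDl -!expRD.
have -> : th - th * (1 - eps) = th * eps by ring.
have -> : - th - th * (1 - eps) = th * eps + - (2 * th) by ring.
rewrite expRD -[X in X + _]mulr1 -mulrDr.
have e2 : th * eps <= kappa / 2.
  have /(ler_wpM2l (ltW th0)) : eps <= kappa ^+ 2 / 2 by rewrite ge_min lexx orbT.
  by move/le_trans; apply; rewrite /th le_eqVlt; apply/orP; left; apply/eqP; field; lra.
have e1 : 1 + expR (- (2 * th)) <= expR (kappa / 2).
  apply: le_trans (expR_ge1Dx _); rewrite lerD2l.
  rewrite expRN -[leRHS]invrK lef_pV2 ?posrE ?expR_gt0 ?invr_gt0 ?divr_gt0 //.
  have -> : (kappa / 2)^-1 = 2 * th by rewrite /th; field; lra.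
  apply: le_trans (expR_ge1Dx _); lra.
have -> : kappa = kappa / 2 + kappa / 2 by lra.
by rewrite expRD; apply: ler_pM => //; rewrite ?ler_expR ?addr_ge0 ?expR_ge0.
Qed.

(** * High powers of the overlap against its square *)

Lemma expR_ge_pow4 (R : realType) (y : R) : 0 <= y -> (y / 4) ^+ 4 <= expR y.
Proof.
move=> y0; have -> : expR y = expR (y / 4) ^+ 4.
  by rewrite -expRM_natl; congr expR; lra.
rewrite lerXn2r ?nnegrE ?expR_ge0 ?divr_ge0 //.
by apply: le_trans (expR_ge1Dx _); lra.
Qed.

Lemma expr_lt_eventually (R : realType) (q e : R) : 0 <= q -> q < 1 -> 0 < e ->
  exists p0, forall p, (p0 <= p)%N -> q ^+ p < e.
Proof.
move=> q0 q1 e0.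
have : q ^+ p @[p --> \oo] --> 0 by apply: cvg_expr; rewrite ger0_norm.
move/cvgrPdist_lt => /(_ _ e0) [p0 _ H]; exists p0 => p /H /=.
by rewrite sub0r normrN ger0_norm // exprn_ge0.
Qed.

(** Two regimes, with x = |r|. If n x^4 <= 1, then n x^p <= n x^8 <= 1 / n. Otherwise large [p]
    makes the exponent at most y = n x^2 / 16, and the spare factor exp(y) >= (y / 4)^4 pays for the
    prefactor of order n^-2. That prefactor later beats the n + 1 of [sum_expR_overlap_sqr]. *)
Lemma far_exponent_bound (R : realType) (L q : R) : 0 <= L -> 0 <= q -> q < 1 ->
  exists p0, forall (p n : nat) (r : R), (p0 <= p)%N -> (0 < n)%N ->
    `|r| <= q ->
    expR (n%:R * (L * `|r| ^+ p))
    <= expR (L / n%:R) + 64 ^+ 4 / n%:R ^+ 2 * expR (n%:R * r ^+ 2 / 8).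
Proof.
move=> L0 q0 q1.
have [p1 Hp1] : exists p0, forall p, (p0 <= p)%N -> q ^+ p < (16 * (L + 1))^-1.
  by apply: expr_lt_eventually => //; rewrite invr_gt0; lra.
(* The 8 yields both x^p <= x^8 and p - 2 >= p1. *)
exists (p1 + 8)%N => p n r pp n0 rq.
have n0R : 0 < n%:R :> R by rewrite ltr0n.
have r0 : 0 <= `|r| by [].
have r1 : `|r| <= 1 by rewrite (le_trans rq) // ltW.
set x := `|r| in r0 r1 rq *.
have -> : r ^+ 2 = x ^+ 2 by rewrite /x real_normK ?num_real.
have [small|large] := leP (n%:R * x ^+ 4) 1.
  apply: ler_wpDr; first by rewrite mulr_ge0 ?expR_ge0 // divr_ge0 ?exprn_ge0.
  rewrite ler_expR.
  have xp : x ^+ p <= x ^+ 8 by apply: ler_wiXn2l => //; apply: leq_trans pp;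
    rewrite leq_addl.
  have y0 : 0 <= x ^+ 4 by rewrite exprn_ge0.
  have E : n%:R * x ^+ 8 <= n%:R^-1.
    rewrite -[leRHS]mul1r ler_pdivlMr //.
    have -> : n%:R * x ^+ 8 * n%:R = (n%:R * x ^+ 4) ^+ 2 by ring.
    by rewrite expr_le1 // mulr_ge0.
  rewrite mulrCA ler_wpM2l //; apply: le_trans E.
  by rewrite ler_pM2l.
apply: ler_wpDl; first exact: expR_ge0.
have x2 : 0 <= x ^+ 2 by rewrite exprn_ge0.
pose y := n%:R * x ^+ 2 / 16.
have y0 : 0 <= y by rewrite divr_ge0 ?mulr_ge0.
apply: (@le_trans _ _ (expR y)).
  rewrite ler_expR /y.
  have -> : p = (2 + (p - 2))%N.
    by rewrite subnKC //; apply: leq_trans pp; rewrite addnC.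
  rewrite exprD.
  have qp : x ^+ (p - 2) <= (16 * (L + 1))^-1.
    apply: le_trans (ltW (Hp1 (p - 2)%N _)); last first.
      by rewrite leq_subRL; [apply: leq_trans pp;
        rewrite addnC leq_add2l|apply: leq_trans pp; rewrite addnC].
    by apply: lerXn2r.
  have Lq : L * x ^+ (p - 2) <= 1 / 16.
    have L1 : 0 < 16 * (L + 1) by lra.
    apply: le_trans (ler_wpM2l L0 qp) _.
    by rewrite ler_pdivrMr //; lra.
  have -> : n%:R * (L * (x ^+ 2 * x ^+ (p - 2)))
    = n%:R * x ^+ 2 * (L * x ^+ (p - 2)) by ring.
  by apply: le_trans (ler_wpM2l _ Lq) _; [exact: mulr_ge0|lra].
have -> : n%:R * x ^+ 2 / 8 = y + y by rewrite /y; lra.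
rewrite expRD mulrA ler_peMl ?expR_ge0 //.
apply: le_trans (ler_wpM2l _ (expR_ge_pow4 y0)); last first.
  by rewrite divr_ge0 ?exprn_ge0.
have -> : 64 ^+ 4 / n%:R ^+ 2 * (y / 4) ^+ 4 = (n%:R * x ^+ 4) ^+ 2.
  by rewrite /y; field; lra.
by rewrite exprn_ege1 // ltW.
Qed.

(** * Means and the event of a nonempty solution set *)

(** Bundles measurability and nonnegativity with a finite mean, so that inequalities between
    expectations can be handled in [R]. *)
Definition ge0_mean d (T : measurableType d) (R : realType)
    (P : probability T R) (f : T -> R) (v : R) : Prop :=
  [/\ measurable_fun setT f, forall w, 0 <= f w &
      (\int[P]_w (f w)%:E = v%:E)%E].

Lemma ge0_mean_cst d (T : measurableType d) (R : realType)
    (P : probability T R) (k : R) : 0 <= k -> ge0_mean P (fun=> k) k.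
Proof.
by move=> k0; split => //; rewrite integral_cst //= probability_setT mule1.
Qed.

Lemma ge0_mean_indic d (T : measurableType d) (R : realType)
    (P : probability T R) (A : set T) : measurable A ->
  ge0_mean P (\1_A : T -> R) (fine (P A)).
Proof.
move=> mA; split; [exact: measurable_indic|by move=> w; rewrite indicE|].
by rewrite integral_indic // setIT fineK // fin_num_measure.
Qed.

Lemma ge0_meanD d (T : measurableType d) (R : realType)
    (P : probability T R) (f g : T -> R) (u v : R) :
  ge0_mean P f u -> ge0_mean P g v -> ge0_mean P (fun w => f w + g w) (u + v).
Proof.
move=> [mf f0 fu] [mg g0 gv]; split.
- exact: measurable_funD.
- by move=> w; rewrite addr_ge0.
- under eq_integral do rewrite EFinD.
  rewrite ge0_integralD //; first by rewrite fu gv.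
  + by move=> w _; rewrite lee_fin.
  + exact/measurable_EFinP.
  + by move=> w _; rewrite lee_fin.
  + exact/measurable_EFinP.
Qed.

Lemma ge0_meanZ d (T : measurableType d) (R : realType)
    (P : probability T R) (k : R) (f : T -> R) (u : R) :
  0 <= k -> ge0_mean P f u -> ge0_mean P (fun w => k * f w) (k * u).
Proof.
move=> k0 [mf f0 fu]; split.
- exact: measurable_funM.
- by move=> w; rewrite mulr_ge0.
- under eq_integral do rewrite EFinM.
  rewrite ge0_integralZl_EFin //; first by rewrite fu.
  + by move=> w _; rewrite lee_fin.
  + exact/measurable_EFinP.
Qed.

Lemma ge0_mean_sum d (T : measurableType d) (R : realType)
    (P : probability T R) (I : finType) (Q : pred I) (f : I -> T -> R)
    (u : I -> R) :
  (forall i, ge0_mean P (f i) (u i)) ->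
  ge0_mean P (fun w => \sum_(i | Q i) f i w) (\sum_(i | Q i) u i).
Proof.
move=> fu; split.
- under eq_fun do rewrite -big_filter.
  by apply: measurable_sum => i; have [] := fu i.
- by move=> w; apply: sumr_ge0 => i _; have [] := fu i.
- rewrite -big_filter; under eq_integral do rewrite -big_filter -sumEFin.
  rewrite ge0_integral_sum //.
  + by rewrite -sumEFin; apply: eq_bigr => i _; have [] := fu i.
  + by move=> i; have [? _ _] := fu i; exact/measurable_EFinP.
  + by move=> i w _; have [_ ? _] := fu i; rewrite lee_fin.
Qed.

Lemma ge0_mean_le d (T : measurableType d) (R : realType)
    (P : probability T R) (f g : T -> R) (u v : R) :
  ge0_mean P f u -> ge0_mean P g v -> (forall w, f w <= g w) -> u <= v.
Proof.
move=> [mf f0 fu] [mg g0 gv] fg; rewrite -lee_fin -fu -gv.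
apply: ge0_le_integral => //.
- by move=> w _; rewrite lee_fin.
- exact/measurable_EFinP.
- exact/measurable_EFinP.
- by move=> w _; rewrite lee_fin.
Qed.

Lemma ge0_mean_expR_hamiltonian (R : realType) d (T : measurableType d)
    (P : probability T R) (n p : nat) (X : {ffun 'I_p -> 'I_n} -> {RV P >-> R})
    (K : finType) (s : K -> Sigma n) (th : K -> R) (b : R) :
  iid_standard_gaussian X -> (0 < n)%N ->
  ge0_mean P
    (fun w => expR (n%:R * (\sum_t th t * hamiltonian (X ^~ w) (s t)) + b))
    (expR (n%:R / 2 * (\sum_t \sum_l th t * th l
        * (n%:R^-1 * overlap R (s t) (s l)) ^+ p) + b)).
Proof.
move=> iidX n0.
have h : ge0_mean P
    (fun w => expR (n%:R * (\sum_t th t * hamiltonian (X ^~ w) (s t))))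
    (expR (n%:R / 2 * (\sum_t \sum_l th t * th l
        * (n%:R^-1 * overlap R (s t) (s l)) ^+ p))).
  split; last exact: expectation_expR_hamiltonian.
  - apply: measurableT_comp; first exact: measurable_expR.
    apply: measurable_funM => //; apply: measurable_sum => t.
    by apply: measurable_funM => //; exact: measurable_hamiltonian.
  - by move=> w; exact: expR_ge0.
have := ge0_meanZ (expR_ge0 b) h.
rewrite -expRD addrC; congr (ge0_mean _ _ _); apply/funext => w.
by rewrite -expRD addrC.
Qed.

(** Boolean and on finite functions, so that tuples can be counted and summed over, and the event of
    a nonempty solution set is a finite union. *)
Definition overlaps_in (R : realType) n m (xi eta : R)
    (s : {ffun 'I_m -> {ffun 'I_n -> bool}}) : bool :=
  [forall t : 'I_m, forall l : 'I_m, (t < l)%N ==>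
     (xi - eta <= n%:R^-1 * overlap R (s t : Sigma n) (s l) <= xi)].

Lemma S_pspin_neq0 (R : realType) (n p : nat) (J : {ffun 'I_p -> 'I_n} -> R)
    (gamma : R) (m : nat) (xi eta : R) :
  S_pspin J gamma m xi eta !=set0 <->
  exists s : {ffun 'I_m -> {ffun 'I_n -> bool}}, overlaps_in xi eta s /\
    forall t, gamma * Num.sqrt (2 * ln 2) <= hamiltonian J (s t : Sigma n).
Proof.
split=> [[s [Hs ov]]|[s [/forallP ov Hs]]].
  exists [ffun t => s t]; split; last by move=> t; rewrite ffunE.
  apply/forallP => t; apply/forallP => l; apply/implyP => tl.
  by rewrite !ffunE; exact: ov.
exists (fun t => s t : Sigma n); split=> [|t l tl]; first exact: Hs.
by have /forallP /(_ l) /implyP /(_ tl) := ov t.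
Qed.

Lemma measurable_S_pspin (R : realType) d (T : measurableType d)
    (P : probability T R) (n p : nat) (X : {ffun 'I_p -> 'I_n} -> {RV P >-> R})
    (gamma : R) (m : nat) (xi eta : R) :
  measurable [set w | S_pspin (fun i => X i w) gamma m xi eta !=set0].
Proof.
rewrite (_ : [set w | _] = \bigcup_(s in [set` overlaps_in xi eta])
    \bigcap_(t in [set: 'I_m]) ((fun w => hamiltonian (X ^~ w)
      (s t : Sigma n)) @^-1` `[gamma * Num.sqrt (2 * ln 2), +oo[)).
  apply: fin_bigcup_measurable => // s _.
  apply: fin_bigcap_measurable => // t _.
  rewrite -[X in measurable X]setTI; apply: measurable_hamiltonian => //.
apply/seteqP; split=> w /=.
  move/S_pspin_neq0 => [s [ov Hs]]; exists s => // t _ /=.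
  by rewrite in_itv /= andbT.
move=> [s ov Hs]; apply/S_pspin_neq0; exists s; split => // t.
by have := Hs t Logic.I; rewrite /= in_itv /= andbT.
Qed.

(** * First moment *)

Lemma overlapC (R : realType) n (s t : Sigma n) : overlap R s t = overlap R t s.
Proof. by apply: eq_bigr => i _; rewrite mulrC. Qed.

Lemma overlapss (R : realType) n (s : Sigma n) : overlap R s s = n%:R.
Proof.
rewrite /overlap (eq_bigr (fun=> 1)) ?sumr_const ?card_ord // => i _.
by rewrite /spin -expr2 sqrr_sign.
Qed.

(** The diagonal term is 1 and the others lie in [0, xi^p]: for large [p] the replicas are nearly
    independent. *)
Lemma overlap_row_bounds (R : realType) n m p (xi eta : R)
    (s : {ffun 'I_m -> {ffun 'I_n -> bool}}) (t : 'I_m) :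
  (0 < n)%N -> 0 <= xi -> eta < xi -> overlaps_in xi eta s ->
  1 <= \sum_l (n%:R^-1 * overlap R (s t : Sigma n) (s l)) ^+ p
    <= 1 + m%:R * xi ^+ p.
Proof.
move=> n0 xi0 ex /forallP ov.
have xi_off l : t != l -> 0 <= n%:R^-1 * overlap R (s t : Sigma n) (s l) <= xi.
  rewrite neq_ltn => /orP[tl|lt].
    have /forallP /(_ l) /implyP /(_ tl) /andP[h1 ->] := ov t.
    by rewrite andbT (le_trans _ h1) // subr_ge0 ltW.
  have /forallP /(_ t) /implyP /(_ lt) /andP[h1 h2] := ov l.
  by rewrite overlapC h2 andbT (le_trans _ h1) // subr_ge0 ltW.
rewrite (bigD1 t) //= overlapss mulVf ?pnatr_eq0 -?lt0n // expr1n.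
rewrite lerDl lerD2l; apply/andP; split.
  by apply: sumr_ge0 => l; rewrite eq_sym => /xi_off /andP[? _]; rewrite exprn_ge0.
apply: (@le_trans _ _ (\sum_(l < m) xi ^+ p)); last first.
  by rewrite sumr_const card_ord mulr_natl.
rewrite [leRHS](bigD1 t) //=; apply: ler_wpDl; first by rewrite exprn_ge0.
apply: ler_sum => l; rewrite eq_sym => /xi_off /andP[h1 h2].
by rewrite lerXn2r // nnegrE.
Qed.

(** Each summand is at least 1 once the overlap reaches n (1 - eps), so the sum dominates the number
    of such configurations. *)
Lemma sum_expR_near (R : realType) n (th eps kappa : R) (s a : Sigma n) :
  (expR th + expR (- th)) * expR (- (th * (1 - eps))) <= expR kappa ->
  \sum_(x : {ffun 'I_n -> bool})
    expR (th * (overlap R s ([ffun i => a i (+) x i] : Sigma n)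
                - n%:R * (1 - eps))) <= expR (n%:R * kappa).
Proof.
move=> hk; under eq_bigr do rewrite mulrBr expRD.
rewrite -mulr_suml sum_expR_overlap.
rewrite (_ : - (th * (n%:R * (1 - eps))) = n%:R * - (th * (1 - eps))); last by ring.
by rewrite !expRM_natl -exprMn lerXn2r ?nnegrE ?expR_ge0 // mulr_ge0 ?addr_ge0 ?expR_ge0.
Qed.

Lemma sum_expR_near_opp (R : realType) n (th eps kappa : R) (s a : Sigma n) :
  (expR th + expR (- th)) * expR (- (th * (1 - eps))) <= expR kappa ->
  \sum_(x : {ffun 'I_n -> bool})
    expR (th * (- overlap R s ([ffun i => a i (+) x i] : Sigma n)
                - n%:R * (1 - eps))) <= expR (n%:R * kappa).
Proof.
move=> hk.
have E x : th * (- overlap R s ([ffun i => a i (+) x i] : Sigma n)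
      - n%:R * (1 - eps)) =
    - th * overlap R s ([ffun i => a i (+) x i] : Sigma n)
      + n%:R * - (th * (1 - eps)) by ring.
under eq_bigr do rewrite E expRD.
rewrite -mulr_suml sum_expR_overlap opprK [expR (- th) + _]addrC.
by rewrite !expRM_natl -exprMn lerXn2r ?nnegrE ?expR_ge0 // mulr_ge0 ?addr_ge0 ?expR_ge0.
Qed.

(** The first replica is free, which costs 2^n; every other one is close to it, which costs exp(n
    kappa). *)
Lemma card_overlaps_in_le (R : realType) n m (th eps kappa xi eta : R) :
  (0 < m)%N -> (0 < n)%N -> 0 < th -> 0 <= kappa -> 1 - eps <= xi - eta ->
  (expR th + expR (- th)) * expR (- (th * (1 - eps))) <= expR kappa ->
  #|@overlaps_in R n m xi eta|%:R <= 2 ^+ n * expR (n%:R * kappa) ^+ m :> R.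
Proof.
move=> m0 n0 th0 k0 heps hk; have n0R : 0 < n%:R :> R by rewrite ltr0n.
pose t0 := Ordinal m0.
pose w (a : {ffun 'I_n -> bool}) (t : 'I_m) (x : {ffun 'I_n -> bool}) : R :=
  if t == t0 then (x == a)%:R
  else expR (th * (overlap R (a : Sigma n) x - n%:R * (1 - eps))).
have w0 a t x : 0 <= w a t x by rewrite /w; case: ifP; rewrite ?expR_ge0.
rewrite -sum1_card natr_sum.
apply: (@le_trans _ _ (\sum_a \sum_(s : {ffun 'I_m -> {ffun 'I_n -> bool}})
    \prod_t w a t (s t))).
  rewrite exchange_big /= big_mkcond; apply: ler_sum => s _.
  have nn a : 0 <= \prod_t w a t (s t) by apply: prodr_ge0.
  case: ifP => [/forallP /(_ t0) /forallP ov|_]; last exact: sumr_ge0.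
  rewrite (bigD1 (s t0)) //=; apply: ler_wpDr; first exact: sumr_ge0.
  apply: (@le_trans _ _ (\prod_(t < m) 1)); first by rewrite big1.
  apply: ler_prod => t _; rewrite ler01 /= /w.
  case: eqP => [->|/eqP tt0]; first by rewrite eqxx.
  have /implyP/(_ _)/andP[|h _] := ov t.
    by rewrite lt0n; apply: contra tt0 => /eqP h; apply/eqP/val_inj.
  rewrite -[leLHS]expR0 ler_expR; apply: mulr_ge0; first exact: ltW.
  by rewrite subr_ge0 -ler_pdivlMl // (le_trans heps).
apply: (@le_trans _ _ (\sum_(a : {ffun 'I_n -> bool}) expR (n%:R * kappa) ^+ m)).
  apply: ler_sum => a _; rewrite -bigA_distr_bigA /=.
  rewrite -[m in leRHS]card_ord -prodr_const.
  apply: ler_prod => t _; apply/andP; split; first exact: sumr_ge0.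
  rewrite /w; case: eqP => _.
    rewrite (bigD1 a) //= eqxx big1 ?addr0; last by move=> x /negbTE ->.
    by rewrite -[leLHS]expR0 ler_expR mulr_ge0 // ltW.
  have := sum_expR_near (a : Sigma n) [ffun=> false] hk.
  apply: le_trans; apply: ler_sum => x _.
  suff -> : [ffun i => [ffun=> false] i (+) x i] = x by [].
  by apply/ffunP => i; rewrite !ffunE.
rewrite sumr_const card_ffun card_bool card_ord.
by rewrite -[leLHS]mulr_natl natrX.
Qed.

(** Union bound over tuples with a Chernoff bound at tilt c = gamma sqrt(2 ln 2), the level itself.
    Nearly independent replicas give c^2 / 2 = gamma^2 ln 2 per replica, up to the factor 1 - m
    xi^p. *)
Lemma prob_S_pspin_le (R : realType) d (T : measurableType d)
    (P : probability T R) (n p : nat) (X : {ffun 'I_p -> 'I_n} -> {RV P >-> R})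
    (gamma : R) (m : nat) (xi eta th eps kappa : R) :
  iid_standard_gaussian X -> (0 < n)%N -> (0 < m)%N -> 0 <= gamma ->
  0 <= xi -> eta < xi -> 0 < th -> 0 <= kappa -> 1 - eps <= xi - eta ->
  (expR th + expR (- th)) * expR (- (th * (1 - eps))) <= expR kappa ->
  fine (P [set w | S_pspin (fun i => X i w) gamma m xi eta !=set0]) <=
  expR (n%:R * (ln 2 + m%:R * kappa
                - m%:R * gamma ^+ 2 * ln 2 * (1 - m%:R * xi ^+ p))).
Proof.
move=> iidX n0 m0 g0 xi0 ex th0 k0 heps hk.
have n0R : 0 < n%:R :> R by rewrite ltr0n.
set E := [set w | _].
set c := gamma * Num.sqrt (2 * ln 2).
have ln2 : 0 < ln 2 :> R by rewrite ln_gt0 // ltr1n.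
have c0 : 0 <= c by rewrite mulr_ge0 ?sqrtr_ge0.
have c2 : c ^+ 2 = gamma ^+ 2 * (2 * ln 2).
  by rewrite exprMn sqr_sqrtr // mulr_ge0 // ltW.
pose B (s : {ffun 'I_m -> {ffun 'I_n -> bool}}) : R :=
  \sum_t \sum_l c * c * (n%:R^-1 * overlap R (s t : Sigma n) (s l)) ^+ p.
have mean := @ge0_mean_sum _ _ _ P _ (@overlaps_in R n m xi eta) _ _
  (fun s => ge0_mean_expR_hamiltonian (fun t => s t : Sigma n)
    (fun=> c) (- (n%:R * (m%:R * c ^+ 2))) iidX n0).
apply: (@le_trans _ _ (\sum_(s | @overlaps_in R n m xi eta s)
    expR (n%:R / 2 * B s - n%:R * (m%:R * c ^+ 2)))).
  apply: ge0_mean_le (ge0_mean_indic P (measurable_S_pspin X gamma m xi eta)) mean _ => w.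
  rewrite indicE; have [/set_mem|_] := boolP (w \in _); last first.
    by apply: sumr_ge0 => s _; exact: expR_ge0.
  move=> /= /S_pspin_neq0[s [ov Hs]].
  rewrite (bigD1 s) //=; apply: ler_wpDr.
    by apply: sumr_ge0 => ? _; exact: expR_ge0.
  rewrite -[leLHS]expR0 ler_expR subr_ge0 ler_pM2l // -mulr_sumr expr2 mulrCA.
  rewrite ler_wpM2l //.
  rewrite -[m in leLHS]card_ord mulr_natl -sumr_const.
  by apply: ler_sum => t _; exact: Hs.
apply: (@le_trans _ _ (\sum_(s | @overlaps_in R n m xi eta s)
    expR (- (n%:R * (m%:R * gamma ^+ 2 * ln 2 * (1 - m%:R * xi ^+ p)))))).
  apply: ler_sum => s ov; rewrite ler_expR.
  have : B s <= c ^+ 2 * (m%:R * (1 + m%:R * xi ^+ p)).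
    rewrite /B; under eq_bigr do rewrite -mulr_sumr.
    rewrite -mulr_sumr -expr2 ler_wpM2l ?sqr_ge0 //.
    rewrite -[m in leRHS]card_ord mulr_natl -sumr_const.
    apply: ler_sum => t _.
    by have /andP[_] := overlap_row_bounds p t n0 xi0 ex ov; rewrite card_ord.
  rewrite c2 => /(ler_wpM2l (ltW n0R)); lra.
rewrite sumr_const -[leLHS]mulr_natl.
apply: le_trans (ler_wpM2r (expR_ge0 _) (card_overlaps_in_le m0 n0 th0 k0 heps hk)) _.
have -> : 2 ^+ n = expR (ln 2) ^+ n :> R by rewrite lnK ?posrE.
rewrite -!expRM_natl -!expRD ler_expR.
by rewrite le_eqVlt; apply/orP; left; apply/eqP; ring.
Qed.

(** * Overlap masks and the supercritical regime *)

(** Both regimes bound their error by a multiple of 1 / (n + 1), so this one squeeze serves for both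
    limits. *)
Lemma cvge0_le_harmonic (R : realType) (u : nat -> \bar R) (C : R) (N : nat) :
  (forall n, 0 <= u n)%E ->
  (forall n, (N <= n)%N -> (u n <= (C / n.+1%:R)%:E)%E) ->
  u n @[n --> \oo] --> 0%E.
Proof.
move=> u0 uC; apply: (@squeeze_cvge _ _ _ _ (fun=> 0%E) _ (fun n => (C / n.+1%:R)%:E)).
- by exists N => // n /= Nn; rewrite u0 uC.
- exact: cvg_cst.
- apply: cvg_EFin; first exact: nearW.
  rewrite -[X in _ --> X](mulr0 C).
  by apply: cvgM; [exact: cvg_cst|exact: cvg_harmonic].
Qed.

Lemma expRN_le_harmonic (R : realType) (k : R) (n : nat) : 0 < k ->
  expR (- (n%:R * k)) <= (1 + k^-1) / n.+1%:R.
Proof.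
move=> k0; have nk : 0 <= n%:R * k by rewrite mulr_ge0 // ltW.
rewrite expRN ler_pdivlMr ?ltr0n // mulrC ler_pdivrMr ?expR_gt0 //.
apply: le_trans (ler_wpM2l _ (expR_ge1Dx _)); last by rewrite addr_ge0 // invr_ge0 ltW.
rewrite -natr1.
have -> : (1 + k^-1) * (1 + n%:R * k) = 1 + n%:R * k + k^-1 + n%:R by field; lra.
have := invr_ge0 k; rewrite (ltW k0); lra.
Qed.

Lemma inadmissible_gt (R : realType) (d : nat -> nat -> measure_display)
    (T : forall n p : nat, measurableType (d n p))
    (P : forall n p : nat, probability (T n p) R)
    (J : forall n p : nat, {ffun 'I_p -> 'I_n} -> {RV (P n p) >-> R})
    (iidJ : forall n p : nat, (2 <= p)%N -> iid_standard_gaussian (@J n p))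
    (m : nat) (gamma : R) :
  (0 < m)%N -> 0 < gamma -> 1 < m%:R * gamma ^+ 2 -> inadmissible J m gamma.
Proof.
move=> m0 g0 mg1.
have m0R : 0 < m%:R :> R by rewrite ltr0n.
have ln2 : 0 < ln 2 :> R by rewrite ln_gt0 // ltr1n.
(* The excess exponent [G] is spent as G / 4 on counting tuples and G / 2 on correlations; the
   remaining G / 4 is the decay rate. *)
pose G : R := (m%:R * gamma ^+ 2 - 1) * ln 2.
have G0 : 0 < G by rewrite mulr_gt0 // subr_gt0.
pose kappa := G / 4 / m%:R.
have k0 : 0 < kappa by rewrite !divr_gt0.
have [th [eps [th0 eps0 eps1 hk]]] := near_count_exponent k0.
pose xi := 1 - eps / 4.
have xi0 : 0 <= xi by rewrite /xi; lra.
have xi1 : xi < 1 by rewrite /xi; lra.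
pose A := m%:R * gamma ^+ 2 * ln 2 * m%:R.
have A0 : 0 < A by rewrite !mulr_gt0 // exprn_gt0.
have [p0 Hp0] : exists p0, forall p, (p0 <= p)%N -> xi ^+ p < G / (2 * A).
  by apply: expr_lt_eventually => //; rewrite divr_gt0 // mulr_gt0.
exists xi, (eps / 4); split; first by split; rewrite /xi; lra.
exists p0 => p p2 /Hp0 xip.
apply: (@cvge0_le_harmonic _ _ (1 + (G / 4)^-1) 1) => [n|n n0]; first exact: measure_ge0.
rewrite /prob_nonempty -[leLHS]fineK; last first.
  by rewrite fin_num_measure //; exact: measurable_S_pspin.
rewrite lee_fin; apply: le_trans (expRN_le_harmonic _ _); last by rewrite divr_gt0.
have ex : eps / 4 < xi by rewrite /xi; lra.
have xe : 1 - eps <= xi - eps / 4 by rewrite /xi; lra.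
have := prob_S_pspin_le (iidJ n p p2) n0 m0 (ltW g0) xi0 ex th0 (ltW k0) xe hk.
move/le_trans; apply.
rewrite ler_expR -[leRHS]mulrN ler_wpM2l //.
have mk : m%:R * kappa = G / 4 by rewrite /kappa; field; lra.
have : A * xi ^+ p <= G / 2.
  have -> : G / 2 = A * (G / (2 * A)) by field; lra.
  by rewrite ler_pM2l // ltW.
have -> : m%:R * gamma ^+ 2 * ln 2 * (1 - m%:R * xi ^+ p) = G + ln 2 - A * xi ^+ p.
  by rewrite /G /A; ring.
by rewrite mk; lra.
Qed.

(** * Masks with prescribed pairwise overlaps *)

Lemma sum_sign_mul_ffun (R : realType) m (t l : 'I_m) : t != l ->
  \sum_(f : {ffun 'I_m -> bool}) (-1) ^+ f t * (-1) ^+ f l = 0 :> R.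
Proof.
move=> tl.
(* Flipping the bit at [t] permutes the patterns and negates every summand. *)
pose flip (f : {ffun 'I_m -> bool}) := [ffun j => (j == t) (+) f j].
have flipK : involutive flip.
  by move=> f; apply/ffunP => j; rewrite !ffunE; case: (j == t); case: (f j).
set S := LHS; suff : S = - S by lra.
rewrite {1}/S (reindex_inj (inv_inj flipK)) /= -sumrN.
apply: eq_bigr => f _; rewrite !ffunE eqxx (eq_sym l) (negbTE tl) addFb.
by rewrite signr_addb expr1 mulN1r mulNr.
Qed.

Lemma sum_modn (R : realType) (F : nat -> R) (B q : nat) : (0 < B)%N ->
  \sum_(0 <= i < B * q) F (i %% B)%N = q%:R * \sum_(0 <= i < B) F i.
Proof.
move=> B0; elim: q => [|q IH]; first by rewrite muln0 big_geq // mul0r.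
rewrite mulnS addnC (@big_cat_nat _ _ _ (B * q)%N) //=; last by rewrite leq_addr.
rewrite IH -natr1 mulrDl mul1r; congr (_ + _).
rewrite -{1}(add0n (B * q)%N) big_addn addKn [LHS]big_nat [RHS]big_nat.
apply: eq_bigr => i /andP[_ iB].
by rewrite addnC mulnC modnMDl modn_small.
Qed.

(* On the first [2 ^ m * q] coordinates the columns of the masks run through all
   sign patterns in [{-1, 1}^m] periodically, so distinct masks are orthogonal
   there; on the remaining coordinates all masks are [+1]. *)
Lemma exists_masks (R : realType) (m n q : nat) :
  (2 ^ m * q <= n)%N ->
  exists a : 'I_m -> Sigma n, forall t l, t != l ->
    overlap R (a t) (a l) = n%:R - (2 ^ m * q)%:R.
Proof.
set B := (2 ^ m)%N => Bqn; have B0 : (0 < B)%N by rewrite expn_gt0.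
pose F0 : {ffun 'I_m -> bool} := [ffun=> false].
pose pat i : {ffun 'I_m -> bool} := nth F0 (enum {ffun 'I_m -> bool}) (i %% B).
exists (fun t => [ffun i : 'I_n => (i < B * q)%N && pat i t]) => t l tl.
pose f i : R := (-1) ^+ ((i < B * q)%N && pat i t) * (-1) ^+ ((i < B * q)%N && pat i l).
transitivity (\sum_(0 <= i < n) f i).
  by rewrite big_mkord; apply: eq_bigr => i _; rewrite /spin !ffunE.
rewrite (@big_cat_nat _ _ _ (B * q)%N) //= addrC.
rewrite [X in X + _](_ : _ = n%:R - (B * q)%:R); last first.
  rewrite big_nat (eq_bigr (fun=> 1)); last first.
    by move=> i /andP[h _]; rewrite /f ltnNge h /= mulr1.
  by rewrite -big_nat sumr_const_nat -natrB.
rewrite [X in _ + X](_ : _ = 0) ?addr0 //.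
pose g i : R := (-1) ^+ (nth F0 (enum {ffun 'I_m -> bool}) i t)
  * (-1) ^+ (nth F0 (enum {ffun 'I_m -> bool}) i l).
transitivity (\sum_(0 <= i < B * q) g (i %% B)%N).
  by rewrite !big_nat; apply: eq_bigr => i /andP[_ h]; rewrite /f h.
rewrite sum_modn // (_ : \sum_(0 <= i < B) g i = 0) ?mulr0 //.
apply: etrans (sum_sign_mul_ffun R tl).
rewrite -[RHS]big_enum /= [RHS](big_nth F0).
by rewrite -cardE card_ffun card_bool card_ord.
Qed.

Lemma exists_masks_itv (R : realType) (m : nat) (xi eta : R) :
  0 < eta -> eta < xi -> xi < 1 ->
  exists N, forall n, (N <= n)%N -> (0 < n)%N ->
  exists a : 'I_m -> Sigma n, forall t l, t != l ->
    xi - eta <= n%:R^-1 * overlap R (a t) (a l) <= xi.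
Proof.
move=> eta0 ex xi1; pose B : R := (2 ^ m)%:R.
have B0 : 0 < B by rewrite ltr0n expn_gt0.
exists (Num.truncn (B / eta)).+1 => n Nn n0.
have n0R : 0 < n%:R :> R by rewrite ltr0n.
have nB : B <= eta * n%:R.
  rewrite mulrC -ler_pdivrMr //; apply: (le_trans (ltW (truncnS_gt _))).
  by rewrite ler_nat.
(* Rounding up gives (1 - xi) n <= B q <= (1 - xi) n + B, and B <= eta n keeps the overlap 1 - B q /
   n within [xi - eta, xi]. *)
pose q := (Num.truncn ((1 - xi) * n%:R / B)).+1.
have x0 : 0 <= (1 - xi) * n%:R / B by apply: divr_ge0; [apply: mulr_ge0 => //;
  rewrite subr_ge0 ltW|exact: ltW].
have q1 : (1 - xi) * n%:R <= B * q%:R.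
  by rewrite [leRHS]mulrC -ler_pdivrMr // ltW // truncnS_gt.
have q2 : B * q%:R <= (1 - xi) * n%:R + B.
  rewrite -natr1 mulrDr mulr1 lerD2r mulrC -ler_pdivlMr //.
  by rewrite truncn_le.
have Bq : (2 ^ m * q <= n)%N.
  rewrite -(ler_nat R) natrM -/B; apply: le_trans q2 _; nra.
have [a Ha] := @exists_masks R m n q Bq.
exists a => t l tl; rewrite Ha // natrM -/B ler_pdivlMl // ler_pdivrMl //.
by apply/andP; split; nra.
Qed.

(** * Second moment *)

(* With [Z] the sum of [e] over the good indices, [Z = 0] when none is good, so
   the indicator of that event is at most [(1 - Z / a) ^ 2]. *)
Lemma truncated_second_moment (R : realType) (S : finType) (good : pred S)
    (e U : S -> R) (B : S -> S -> R) (a : R) :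
  0 < a -> (forall s, 0 <= e s) -> (forall s, 0 <= U s) ->
  (forall s s', 0 <= B s s') ->
  (forall s, ~~ good s -> e s <= U s) ->
  (forall s s', good s -> good s' -> e s * e s' <= B s s') ->
  (~~ [exists s, good s])%:R + 2 / a * (\sum_s e s)
  <= 1 + 2 / a * (\sum_s U s) + 1 / a ^+ 2 * (\sum_s \sum_s' B s s').
Proof.
move=> a0 e0 U0 B0 eU eB.
pose Z := \sum_(s | good s) e s.
have Z1 : \sum_s e s <= Z + \sum_s U s.
  rewrite (bigID good) /= lerD2l [leRHS](bigID good) /=.
  by apply: ler_wpDl; [exact: sumr_ge0|exact: ler_sum].
have Z2 : Z ^+ 2 <= \sum_s \sum_s' B s s'.
  rewrite expr2 /Z mulr_suml [leRHS](bigID good) /=; apply: ler_wpDr.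
    by apply: sumr_ge0 => s _; exact: sumr_ge0.
  apply: ler_sum => s gs; rewrite mulr_sumr [leRHS](bigID good) /=.
  by apply: ler_wpDr; [exact: sumr_ge0|apply: ler_sum => s' gs'; exact: eB].
have Z3 : (~~ [exists s, good s])%:R + 2 / a * Z <= 1 + 1 / a ^+ 2 * Z ^+ 2.
  have E : 1 + 1 / a ^+ 2 * Z ^+ 2 - 2 / a * Z = (1 - Z / a) ^+ 2 by field; lra.
  have [/existsP[s gs]|/existsPn ng] := boolP [exists s, good s].
    by rewrite /= add0r -subr_ge0 E sqr_ge0.
  have -> : Z = 0 by apply: big1 => s gs; have := ng s; rewrite gs.
  by rewrite expr0n /= !mulr0 !addr0.
have a20 : 0 <= 2 / a by rewrite divr_ge0 // ltW.
have a2 : 0 <= 1 / a ^+ 2 by rewrite divr_ge0 // exprn_ge0 // ltW.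
have := ler_wpM2l a20 Z1; have := ler_wpM2l a2 Z2; lra.
Qed.

Lemma sum_eqb_mul (R : realType) (I : finType) (t : I) (F : I -> R) :
  \sum_l (l == t)%:R * F l = F t.
Proof.
rewrite (bigD1 t) //= eqxx mul1r big1 ?addr0 // => l /negbTE ->.
by rewrite mul0r.
Qed.

(** Expands the quadratic form of [K] at the vector with all entries [x] except x + y at [t]: the
    exponent obtained when the tilt of one replica is changed by [y]. *)
Lemma quad_form_perturb (R : realType) (I : finType) (K : I -> I -> R) (t : I)
    (x y : R) :
  (forall i j, K i j = K j i) ->
  \sum_i \sum_j (x + (i == t)%:R * y) * (x + (j == t)%:R * y) * K i j =
  x ^+ 2 * (\sum_i \sum_j K i j) + 2 * x * y * (\sum_j K t j) + y ^+ 2 * K t t.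
Proof.
move=> Ksym.
have row i : \sum_j (x + (i == t)%:R * y) * (x + (j == t)%:R * y) * K i j =
    (x + (i == t)%:R * y) * (x * (\sum_j K i j) + y * K i t).
  rewrite -[K i t](sum_eqb_mul t (K i)) !mulr_sumr -big_split mulr_sumr /=.
  by apply: eq_bigr => j _; ring.
under eq_bigr do rewrite row.
have split2 i : (x + (i == t)%:R * y) * (x * (\sum_j K i j) + y * K i t) =
    (x ^+ 2 * (\sum_j K i j) + x * y * K t i)
    + (i == t)%:R * (y * (x * (\sum_j K i j) + y * K i t)).
  by rewrite (Ksym i t); ring.
under eq_bigr do rewrite split2.
rewrite big_split /= sum_eqb_mul big_split /= -!mulr_sumr; ring.
Qed.

(** The signs of [s] cancel, so every [s] turns the masks into a tuple with the same overlaps. *)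
Lemma overlap_shift (R : realType) n (a b s : {ffun 'I_n -> bool}) :
  overlap R ([ffun i => a i (+) s i] : Sigma n) ([ffun i => b i (+) s i] : Sigma n)
  = overlap R (a : Sigma n) b.
Proof.
apply: eq_bigr => i _; rewrite /spin !ffunE.
by case: (a i); case: (b i); case: (s i); rewrite /= ?expr1 ?expr0; lra.
Qed.

(** All m^2 terms are bounded by the largest |r t l|, to which the one-variable hypothesis applies;
    the sum on the right contains the exponential at that pair. *)
Lemma far_cross_bound (R : realType) (m n p : nat) (lam q M : R)
    (r : 'I_m -> 'I_m -> R) :
  (0 < m)%N -> 0 <= M ->
  (forall x : R, `|x| <= q ->
    expR (n%:R * (lam ^+ 2 * m%:R ^+ 2 * `|x| ^+ p))
    <= expR (lam ^+ 2 * m%:R ^+ 2 / n%:R) + M * expR (n%:R * x ^+ 2 / 8)) ->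
  (forall t l, `|r t l| <= q) ->
  expR (n%:R * (lam ^+ 2 * \sum_t \sum_l r t l ^+ p)) <=
  expR (lam ^+ 2 * m%:R ^+ 2 / n%:R)
  + M * \sum_t \sum_l expR (n%:R * r t l ^+ 2 / 8).
Proof.
move=> m0 M0 hfar rq; pose t0 := Ordinal m0.
have [k kmax] : exists k : 'I_m * 'I_m, forall t l, `|r t l| <= `|r k.1 k.2|.
  pose F (k : 'I_m * 'I_m) := `|r k.1 k.2|.
  case: (@arg_maxP _ _ _ (t0, t0) predT F isT) => k _ kmax.
  by exists k => t l; exact: (kmax (t, l)).
apply: le_trans (le_trans (hfar _ (rq k.1 k.2)) _).
  rewrite ler_expR ler_wpM2l // -mulrA ler_wpM2l ?sqr_ge0 //.
  have -> : m%:R ^+ 2 * `|r k.1 k.2| ^+ p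
      = \sum_(t < m) \sum_(l < m) `|r k.1 k.2| ^+ p.
    by rewrite !sumr_const card_ord -mulrnA -[RHS]mulr_natl natrM expr2.
  apply: ler_sum => t _; apply: ler_sum => l _.
  apply: le_trans (ler_norm _) _; rewrite normrX.
  by rewrite lerXn2r // nnegrE.
rewrite lerD2l ler_wpM2l // (bigD1 k.1) //= (bigD1 k.2) //= -addrA lerDl.
apply: addr_ge0; first by apply: sumr_ge0 => l _; exact: expR_ge0.
by apply: sumr_ge0 => t _; apply: sumr_ge0 => l _; exact: expR_ge0.
Qed.

Lemma mul_sqr_normalized (R : realType) (n : nat) (x : R) : (0 < n)%N ->
  n%:R * (n%:R^-1 * x) ^+ 2 / 8 = x ^+ 2 / (8 * n%:R).
Proof.
move=> n0; have : n%:R != 0 :> R by rewrite pnatr_eq0 -lt0n.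
by move=> ?; field.
Qed.

(** With [s] fixed, far [s'] are summed through the quadratic exponential moment, and near [s'] are
    counted by Chernoff weights. *)
Lemma sum_expR_cross_le (R : realType) (m n : nat) (th eps kappa : R)
    (D Y N0 M : R) (a : {ffun 'I_m -> {ffun 'I_n -> bool}})
    (s : {ffun 'I_n -> bool})
    (b : {ffun 'I_n -> bool} -> R) :
  let ov (s' : {ffun 'I_n -> bool}) (t l : 'I_m) :=
    overlap R ([ffun i => a t i (+) s i] : Sigma n)
              ([ffun i => a l i (+) s' i] : Sigma n) in
  (0 < n)%N -> 0 <= D -> 0 <= Y -> 0 <= N0 -> 0 <= M -> 0 < th ->
  (expR th + expR (- th)) * expR (- (th * (1 - eps))) <= expR kappa ->
  (forall s', (forall t l, `|n%:R^-1 * ov s' t l| <= 1 - eps) ->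
    b s' <= D * (N0 + M * \sum_t \sum_l
                   expR (n%:R * (n%:R^-1 * ov s' t l) ^+ 2 / 8))) ->
  (forall s', ~ (forall t l, `|n%:R^-1 * ov s' t l| <= 1 - eps) -> b s' <= Y) ->
  \sum_s' b s' <= D * (2 ^+ n * N0 + M * (m%:R ^+ 2 * (2 ^+ n * n.+1%:R)))
                  + Y * (2 * m%:R ^+ 2 * expR (n%:R * kappa)).
Proof.
move=> ov n0 D0 Y0 N00 M0 th0 hk bfar bnear.
have n0R : 0 < n%:R :> R by rewrite ltr0n.
pose Q s' t l : R := expR (n%:R * (n%:R^-1 * ov s' t l) ^+ 2 / 8).
(* At least 1 when the cross overlap exceeds n (1 - eps) in absolute value; one term for each sign,
   hence the factor 2 m^2. *)
pose F s' t l : R := expR (th * (ov s' t l - n%:R * (1 - eps)))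
  + expR (th * (- ov s' t l - n%:R * (1 - eps))).
have F0 s' t l : 0 <= F s' t l by rewrite addr_ge0 ?expR_ge0.
have Q0 s' t l : 0 <= Q s' t l by rewrite expR_ge0.
have cst2 (c : R) : \sum_(t < m) \sum_(l < m) c = m%:R ^+ 2 * c.
  by rewrite !sumr_const card_ord -mulrnA -[LHS]mulr_natl natrM expr2.
apply: (@le_trans _ _ (\sum_s' (D * (N0 + M * \sum_t \sum_l Q s' t l)
    + Y * \sum_t \sum_l F s' t l))).
  apply: ler_sum => s' _.
  have SF0 : 0 <= \sum_t \sum_l F s' t l.
    by apply: sumr_ge0 => t _; apply: sumr_ge0.
  have SQ0 : 0 <= \sum_t \sum_l Q s' t l.
    by apply: sumr_ge0 => t _; apply: sumr_ge0.
  have [far|near] := pselect (forall t l, `|n%:R^-1 * ov s' t l| <= 1 - eps).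
    by apply: ler_wpDr; [exact: mulr_ge0|exact: bfar].
  apply: ler_wpDl; first by rewrite mulr_ge0 // addr_ge0 // mulr_ge0.
  apply: le_trans (bnear _ near) _; rewrite -[leLHS]mulr1 ler_wpM2l //.
  have [t [l tl]] : exists t l, 1 - eps < `|n%:R^-1 * ov s' t l|.
    apply: contrapT => h; apply: near => t l; rewrite leNgt; apply/negP => h'.
    by apply: h; exists t, l.
  rewrite (bigD1 t) //= (bigD1 l) //= -addrA; apply: ler_wpDr.
    by apply: addr_ge0; apply: sumr_ge0 => ? _ //; apply: sumr_ge0.
  move: tl; rewrite lter_normr /F => /orP[tl|tl].
    apply: ler_wpDr; first exact: expR_ge0.
    rewrite -[leLHS]expR0 ler_expR; apply: mulr_ge0; first exact: ltW.
    by rewrite subr_ge0 -ler_pdivlMl // ltW.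
  apply: ler_wpDl; first exact: expR_ge0.
  rewrite -[leLHS]expR0 ler_expR; apply: mulr_ge0; first exact: ltW.
  by rewrite subr_ge0 -ler_pdivlMl // mulrN ltW.
rewrite big_split /= -!mulr_sumr; apply: lerD; apply: ler_wpM2l => //.
  rewrite big_split /= -mulr_sumr; apply: lerD.
    by rewrite sumr_const card_ffun card_bool card_ord -[leLHS]mulr_natl natrX.
  apply: ler_wpM2l => //; rewrite exchange_big /= -cst2.
  apply: ler_sum => t _; rewrite exchange_big /=; apply: ler_sum => l _.
  apply: le_trans (sum_expR_overlap_sqr R _ (a l) n0).
  by apply: ler_sum => s' _; rewrite /Q /ov mul_sqr_normalized.
rewrite exchange_big /= [2 * _]mulrC -mulrA -cst2.
apply: ler_sum => t _; rewrite exchange_big /=; apply: ler_sum => l _.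
rewrite big_split /= mulrDl mul1r; apply: lerD.
  exact: sum_expR_near.
exact: sum_expR_near_opp.
Qed.

(** The four error terms are, in order: mass lost to the truncation, far pairs with negligible
    overlaps, the other far pairs, near pairs. *)
Lemma not_prob_S_pspin_le (R : realType) d (T : measurableType d)
    (P : probability T R) (n p : nat) (X : {ffun 'I_p -> 'I_n} -> {RV P >-> R})
    (gamma : R) (m : nat) (xi eta th eps kappa lam dl M : R)
    (a : {ffun 'I_m -> {ffun 'I_n -> bool}}) :
  iid_standard_gaussian X -> (0 < n)%N -> (0 < m)%N ->
  0 <= xi -> eta < xi -> 0 < th ->
  (expR th + expR (- th)) * expR (- (th * (1 - eps))) <= expR kappa ->
  overlaps_in xi eta a ->
  0 < dl -> gamma * Num.sqrt (2 * ln 2) + dl <= lam -> 0 < lam ->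
  lam * (m%:R * xi ^+ p) <= dl / 4 ->
  0 <= M ->
  (forall x : R, `|x| <= 1 - eps ->
    expR (n%:R * (lam ^+ 2 * m%:R ^+ 2 * `|x| ^+ p))
    <= expR (lam ^+ 2 * m%:R ^+ 2 / n%:R) + M * expR (n%:R * x ^+ 2 / 8)) ->
  kappa - ln 2 + lam ^+ 2 * m%:R / 2 + lam * m%:R * dl <= - kappa ->
  fine (P (~` [set w | S_pspin (fun i => X i w) gamma m xi eta !=set0])) <=
  4 * m%:R * expR (- (n%:R * (dl ^+ 2 / 4)))
  + (expR (lam ^+ 2 * m%:R ^+ 2 / n%:R) - 1)
  + M * (m%:R ^+ 2 * n.+1%:R) + 2 * m%:R ^+ 2 * expR (- (n%:R * kappa)).
Proof.
move=> iidX n0 m0 xi0 ex th0 hk ova dl0 glam lam0 lamxi M0 hfar hkap.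
have n0R : 0 < n%:R :> R by rewrite ltr0n.
have m0R : 0 < m%:R :> R by rewrite ltr0n.
set E := [set w | _].
pose S := {ffun 'I_n -> bool}.
pose sg (t : 'I_m) (s : S) : Sigma n := [ffun i => a t i (+) s i].
pose H t s w := hamiltonian (X ^~ w) (sg t s).
pose K t l : R := (n%:R^-1 * overlap R (a t : Sigma n) (a l)) ^+ p.
have KE s t l : (n%:R^-1 * overlap R (sg t s) (sg l s)) ^+ p = K t l.
  by rewrite /sg overlap_shift.
have Ksym t l : K t l = K l t by rewrite /K overlapC.
have Ktt t : K t t = 1 by rewrite /K overlapss mulVf ?expr1n // gt_eqF.
have Krow t : 1 <= \sum_l K t l <= 1 + m%:R * xi ^+ p.
  exact: overlap_row_bounds n0 xi0 ex ova.
pose v := \sum_t \sum_l K t l.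
have vm : m%:R <= v.
  rewrite -[m in leLHS]card_ord -sumr_const; apply: ler_sum => t _.
  by have /andP[] := Krow t.
pose D := expR (n%:R / 2 * (lam ^+ 2 * v)).
have D0 : 0 < D by exact: expR_gt0.
pose N : R := 2 ^+ n.
have N0 : 0 < N by rewrite exprn_gt0.
pose e (s : S) w := expR (n%:R * (\sum_t lam * H t s w) + 0).
(* [Up] and [Dn] are [e] times exp(n dl (H_t - lam - dl)) and exp(n dl (lam - dl - H_t)), so they
   dominate [e] when H_t leaves the window above or below. *)
pose Up t (s : S) w :=
  expR (n%:R * (\sum_l (lam + (l == t)%:R * dl) * H l s w)
        + - (n%:R * (dl * (lam + dl)))).
pose Dn t (s : S) w :=
  expR (n%:R * (\sum_l (lam + (l == t)%:R * - dl) * H l s w)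
        + n%:R * (dl * (lam - dl))).
have eM s : ge0_mean P (e s) D.
  have := ge0_mean_expR_hamiltonian (fun t => sg t s) (fun=> lam) 0 iidX n0.
  rewrite addr0; congr (ge0_mean _ _ (expR (_ * _))).
  rewrite /v mulr_sumr; apply: eq_bigr => t _.
  by rewrite mulr_sumr; apply: eq_bigr => l _; rewrite KE expr2.
have UpM t s : exists2 u, ge0_mean P (Up t s) u &
    u <= D * expR (- (n%:R * (dl ^+ 2 / 4))).
  eexists; first exact: (ge0_mean_expR_hamiltonian (fun t => sg t s) _ _ iidX n0).
  under eq_bigr do under eq_bigr do rewrite KE.
  rewrite quad_form_perturb // Ktt -/v -expRD ler_expR.
  have /andP[_ h] := Krow t; set k := \sum_j _ in h *.
  (* Under the tilt H_t has mean [lam * k]; a drift of at most dl / 4 leaves the rate dl (dl / 2 -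
     dl / 4) = dl^2 / 4. Downwards, k >= 1 alone suffices. *)
  have h1 : lam * k <= lam + dl / 4.
    by apply: le_trans (ler_wpM2l (ltW lam0) h) _; rewrite mulrDr mulr1 lerD2l.
  have h2 : n%:R * (dl * (lam * k)) <= n%:R * (dl * (lam + dl / 4)).
    by rewrite ler_pM2l // ler_pM2l.
  by move: h2; lra.
have DnM t s : exists2 u, ge0_mean P (Dn t s) u &
    u <= D * expR (- (n%:R * (dl ^+ 2 / 4))).
  eexists; first exact: (ge0_mean_expR_hamiltonian (fun t => sg t s) _ _ iidX n0).
  under eq_bigr do under eq_bigr do rewrite KE.
  rewrite quad_form_perturb // Ktt -/v -expRD ler_expR.
  have /andP[h _] := Krow t; set k := \sum_j _ in h *.
  have h2 : n%:R * (dl * (lam * 1)) <= n%:R * (dl * (lam * k)).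
    by rewrite !ler_pM2l.
  have : 0 <= n%:R * (dl * dl) by rewrite !mulr_ge0 // ltW.
  by move: h2; lra.
(* The 2m configurations of a far pair form one family, to which the moment formula applies at
   once. *)
pose pair (s s' : S) (k : 'I_m + 'I_m) : Sigma n :=
  match k with inl t => sg t s | inr t => sg t s' end.
pose far (s s' : S) := [forall t : 'I_m, forall l : 'I_m,
  `|n%:R^-1 * overlap R (sg t s) (sg l s')| <= 1 - eps].
(* On a good [s'] the truncation gives e s' <= exp(Y); near pairs use this in place of their joint
   moment. *)
pose Y := n%:R * (lam * (m%:R * (lam + dl))).
pose B (s s' : S) w :=
  if far s s'
  then expR (n%:R * (\sum_k lam * hamiltonian (X ^~ w) (pair s s' k)) + 0)
  else expR (n%:R * (\sum_t lam * H t s w) + Y).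
pose C (s s' : S) : R :=
  \sum_t \sum_l (n%:R^-1 * overlap R (sg t s) (sg l s')) ^+ p.
pose bs (s s' : S) : R :=
  if far s s' then D ^+ 2 * expR (n%:R * (lam ^+ 2 * C s s')) else D * expR Y.
have within s : \sum_t \sum_l lam * lam
    * (n%:R^-1 * overlap R (sg t s) (sg l s)) ^+ p = lam ^+ 2 * v.
  rewrite /v mulr_sumr; apply: eq_bigr => t _.
  by rewrite mulr_sumr; apply: eq_bigr => l _; rewrite KE expr2.
have cross s s' : \sum_t \sum_l lam * lam
    * (n%:R^-1 * overlap R (sg t s) (sg l s')) ^+ p = lam ^+ 2 * C s s'.
  rewrite /C mulr_sumr; apply: eq_bigr => t _.
  by rewrite mulr_sumr; apply: eq_bigr => l _; rewrite expr2.
have CC s s' : C s' s = C s s'.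
  rewrite /C exchange_big /=; apply: eq_bigr => t _; apply: eq_bigr => l _.
  by rewrite overlapC.
have BM s s' : ge0_mean P (B s s') (bs s s').
  rewrite /B /bs; case: ifP => _.
    have := ge0_mean_expR_hamiltonian (pair s s') (fun=> lam) 0 iidX n0.
    congr (ge0_mean _ _ _).
    rewrite addr0 /D expr2 -!expRD; congr expR.
    rewrite big_sumType /=.
    under [X in X + _]eq_bigr do rewrite big_sumType /=.
    under [X in _ + X]eq_bigr do rewrite big_sumType /=.
    by rewrite !big_split /= !within !cross CC; lra.
  have := ge0_mean_expR_hamiltonian (fun t => sg t s) (fun=> lam) Y iidX n0.
  by rewrite within expRD.
pose good w (s : S) := [forall t, lam - dl <= H t s w <= lam + dl].
pose up t s := s2val (cid2 (UpM t s)).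
pose dn t s := s2val (cid2 (DnM t s)).
have upM t s : ge0_mean P (Up t s) (up t s) by exact: (s2valP (cid2 (UpM t s))).
have dnM t s : ge0_mean P (Dn t s) (dn t s) by exact: (s2valP (cid2 (DnM t s))).
pose Z := N * D.
have Z0 : 0 < Z by exact: mulr_gt0.
have z2 : 0 <= 2 / Z by rewrite divr_ge0 // ltW.
have z1 : 0 <= 1 / Z ^+ 2 by rewrite divr_ge0 // exprn_ge0 // ltW.
have mE : measurable E by exact: measurable_S_pspin.
have lhsM := ge0_meanD (ge0_mean_indic P (measurableC mE))
  (ge0_meanZ z2 (ge0_mean_sum predT eM)).
have rhsM := ge0_meanD (ge0_meanD (ge0_mean_cst P (ler01 : (0 : R) <= 1))
  (ge0_meanZ z2 (ge0_mean_sum predT (fun s => ge0_mean_sum predT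
    (fun t => ge0_meanD (upM t s) (dnM t s))))))
  (ge0_meanZ z1 (ge0_mean_sum predT (fun s => ge0_mean_sum predT (BM s)))).
have := ge0_mean_le lhsM rhsM.
have bad_le w s : ~~ good w s -> e s w <= \sum_t (Up t s w + Dn t s w).
  move=> /forallPn[t]; rewrite negb_and -!ltNge => tH.
  rewrite (bigD1 t) //=; apply: ler_wpDr.
    by apply: sumr_ge0 => l _; rewrite addr_ge0 ?expR_ge0.
  have tilt x : \sum_l (lam + (l == t)%:R * x) * H l s w
      = \sum_l lam * H l s w + x * H t s w.
    rewrite -(sum_eqb_mul t (fun l => H l s w)) mulr_sumr -big_split /=.
    by apply: eq_bigr => l _; ring.
  case/orP: tH => tH.
    apply: ler_wpDl; first exact: expR_ge0.
    rewrite ler_expR tilt.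
    have : 0 <= n%:R * (dl * (lam - dl - H t s w)).
      by rewrite !mulr_ge0 ?(ltW n0R) ?(ltW dl0) // subr_ge0 ltW.
    lra.
  apply: ler_wpDr; first exact: expR_ge0.
  rewrite ler_expR tilt.
  have : 0 <= n%:R * (dl * (H t s w - (lam + dl))).
    by rewrite !mulr_ge0 ?(ltW n0R) ?(ltW dl0) // subr_ge0 ltW.
  lra.
have pair_le w s s' : good w s -> good w s' -> e s w * e s' w <= B s s' w.
  move=> /forallP gs /forallP gs'; rewrite /e /B -expRD.
  case: ifP => _; rewrite ler_expR.
    by rewrite big_sumType /= /H; lra.
  rewrite !addr0 lerD2l /Y ler_wpM2l // -mulr_sumr ler_wpM2l ?(ltW lam0) //.
  rewrite mulr_natl -[m in leRHS]card_ord -sumr_const.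
  by apply: ler_sum => t _; have /andP[] := gs' t.
have pointwise w : (\1_(~` E) w : R) + 2 / Z * (\sum_s e s w) <=
    1 + 2 / Z * (\sum_s \sum_t (Up t s w + Dn t s w))
    + 1 / Z ^+ 2 * (\sum_s \sum_s' B s s' w).
  apply: le_trans (@truncated_second_moment R S (good w) (e^~ w)
    (fun s => \sum_t (Up t s w + Dn t s w)) (fun s s' => B s s' w) Z Z0 _ _ _
    (bad_le w) (pair_le w)).
  - rewrite lerD2r indicE.
    have [/existsP[s /forallP gs]|_] := boolP [exists s, good w s]; last first.
      by rewrite lern1 leq_b1.
    rewrite memNset //= => nE; apply: nE; apply/S_pspin_neq0.
    exists [ffun t => [ffun i => a t i (+) s i]]; split.
      apply/forallP => t; apply/forallP => l; apply/implyP => tl.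
      rewrite !ffunE overlap_shift.
      by have /forallP /(_ t) /forallP /(_ l) /implyP /(_ tl) := ova.
    move=> t; rewrite ffunE; have /andP[h _] := gs t.
    by apply: le_trans h; lra.
  - by move=> s; exact: expR_ge0.
  - by move=> s; apply: sumr_ge0 => t _; rewrite addr_ge0 ?expR_ge0.
  - by move=> s s'; rewrite /B; case: ifP => _; exact: expR_ge0.
move=> /(_ pointwise).
(* [Z] is the mean of the sum of the [e s]. This 2 absorbs the constant 1 and the leading 1 of the
   second moment, leaving [expR L - 1]. *)
have -> : 2 / Z * \sum_(s : S) D = 2.
  rewrite sumr_const card_ffun card_bool card_ord -[X in _ * X]mulr_natl natrX.
  by rewrite mulfVK // gt_eqF.
pose x := expR (- (n%:R * (dl ^+ 2 / 4))).
have U_le : 2 / Z * (\sum_(s : S) \sum_t (up t s + dn t s)) <= 4 * m%:R * x.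
  have : \sum_(s : S) \sum_t (up t s + dn t s) <= \sum_(s : S) \sum_(t < m) (2 * (D * x)).
    apply: ler_sum => s _; apply: ler_sum => t _; rewrite mulr_natl mulr2n.
    by apply: lerD; [exact: (s2valP' (cid2 (UpM t s)))|exact: (s2valP' (cid2 (DnM t s)))].
  rewrite !sumr_const card_ffun card_bool !card_ord -[in leRHS]mulrnA -[leRHS]mulr_natl.
  rewrite natrM natrX => /(ler_wpM2l z2) /le_trans; apply.
  rewrite le_eqVlt; apply/orP; left; apply/eqP; rewrite -/N /Z.
  by field; rewrite !gt_eqF.
pose L := lam ^+ 2 * m%:R ^+ 2 / n%:R.
have B_le : 1 / Z ^+ 2 * (\sum_(s : S) \sum_s' bs s s') <=
    expR L + M * (m%:R ^+ 2 * n.+1%:R) + 2 * m%:R ^+ 2 * expR (- (n%:R * kappa)).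
  have row s : \sum_s' bs s s' <= D ^+ 2 * (N * expR L
      + M * (m%:R ^+ 2 * (N * n.+1%:R)))
      + D * expR Y * (2 * m%:R ^+ 2 * expR (n%:R * kappa)).
    apply: (sum_expR_cross_le (a := a) (s := s) n0 _ _ _ M0 th0 hk).
    - by rewrite exprn_ge0 // ltW.
    - by rewrite mulr_ge0 ?expR_ge0.
    - exact: expR_ge0.
    - move=> s' fs; rewrite /bs ifT; last first.
        by apply/forallP => t; apply/forallP => l; exact: fs.
      apply: ler_wpM2l; first by rewrite exprn_ge0 // ltW.
      exact: (far_cross_bound (q := 1 - eps)).
    - move=> s' fs; rewrite /bs ifF //; apply/negP => /forallP h; apply: fs => t l.
      by have /forallP := h t; apply.
  have : \sum_(s : S) \sum_s' bs s s' <= N * (D ^+ 2 * (N * expR L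
      + M * (m%:R ^+ 2 * (N * n.+1%:R)))
      + D * expR Y * (2 * m%:R ^+ 2 * expR (n%:R * kappa))).
    apply: le_trans (ler_sum _ (fun s _ => row s)) _.
    by rewrite sumr_const card_ffun card_bool card_ord -[leLHS]mulr_natl natrX.
  move=> /(ler_wpM2l z1) /le_trans; apply.
  (* The subcritical gap enters here: by v >= m and [hkap], the truncated near pairs are
     exponentially smaller than Z = 2^n D. *)
  have YE : expR Y * expR (n%:R * kappa) <= expR (- (n%:R * kappa)) * Z.
    have NE : N = expR (n%:R * ln 2) by rewrite expRM_natl lnK ?posrE.
    rewrite /Z NE /D -!expRD ler_expR /Y.
    have h1 := ler_wpM2l (ltW n0R) hkap.
    have h2 : n%:R / 2 * (lam ^+ 2 * m%:R) <= n%:R / 2 * (lam ^+ 2 * v).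
      by rewrite ler_wpM2l ?divr_ge0 // ler_wpM2l // sqr_ge0.
    by move: h1 h2; lra.
  have -> : 1 / Z ^+ 2 * (N * (D ^+ 2 * (N * expR L
      + M * (m%:R ^+ 2 * (N * n.+1%:R)))
      + D * expR Y * (2 * m%:R ^+ 2 * expR (n%:R * kappa))))
    = expR L + M * (m%:R ^+ 2 * n.+1%:R)
      + 2 * m%:R ^+ 2 * (expR Y * expR (n%:R * kappa) / Z).
    by rewrite /Z; field; rewrite !gt_eqF.
  rewrite lerD2l ler_wpM2l ?mulr_ge0 ?sqr_ge0 //.
  by rewrite ler_pdivrMr.
move: U_le B_le; rewrite -/x -/L; lra.
Qed.

(** * The threshold *)

Lemma expR_sub1_le_harmonic (R : realType) (L : R) (n : nat) :
  0 <= L -> (0 < n)%N -> 2 * L <= n%:R ->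
  expR (L / n%:R) - 1 <= 4 * L / n.+1%:R.
Proof.
move=> L0 n0 Ln; have n0R : 1 <= n%:R :> R by rewrite ler1n.
have Ln2 : L / n%:R <= 1 / 2 by rewrite ler_pdivrMr; lra.
have x0 : 0 <= L / n%:R by rewrite divr_ge0.
apply: (@le_trans _ _ (2 * (L / n%:R))).
  rewrite lerBlDr; apply: le_trans (expR_le_inv1B _) _; first lra.
  by rewrite -div1r ler_pdivrMr; [nra|lra].
rewrite ler_pdivlMr ?ltr0n // -[n.+1%:R]natr1.
have -> : 2 * (L / n%:R) * (n%:R + 1) = 2 * L + 2 * (L / n%:R) by field; lra.
have : L / n%:R <= L by rewrite ler_pdivrMr; [nra|lra].
lra.
Qed.

Lemma admissible_lt (R : realType) (d : nat -> nat -> measure_display)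
    (T : forall n p : nat, measurableType (d n p))
    (P : forall n p : nat, probability (T n p) R)
    (J : forall n p : nat, {ffun 'I_p -> 'I_n} -> {RV (P n p) >-> R})
    (iidJ : forall n p : nat, (2 <= p)%N -> iid_standard_gaussian (@J n p))
    (m : nat) (gamma : R) :
  (0 < m)%N -> 0 < gamma -> m%:R * gamma ^+ 2 < 1 -> admissible J m gamma.
Proof.
move=> m0 g0 mg1 xi eta eta0 ex xi1.
have xi0 : 0 <= xi by lra.
have m0R : 0 < m%:R :> R by rewrite ltr0n.
have ln2 : 0 < ln 2 :> R by rewrite ln_gt0 // ltr1n.
pose c := gamma * Num.sqrt (2 * ln 2).
have c0 : 0 < c by rewrite mulr_gt0 // sqrtr_gt0 mulr_gt0.
have c2 : c ^+ 2 = gamma ^+ 2 * (2 * ln 2).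
  by rewrite exprMn sqr_sqrtr // mulr_ge0 // ltW.
pose gap := (1 - m%:R * gamma ^+ 2) * ln 2.
have gap0 : 0 < gap by rewrite mulr_gt0 // subr_gt0.
(* Since m c^2 / 2 = ln 2 - gap, widening the level by [dl] costs at most m dl (2 c + 2) when dl <=
   1. This [D] caps the cost at gap / 2, and the other half is 2 kappa. *)
pose D := 2 * m%:R * (2 * c + 2).
have D0 : 0 < D by rewrite !mulr_gt0 //; lra.
pose dl := Num.min 1 (gap / D).
have dl0 : 0 < dl by rewrite lt_min ltr01 divr_gt0.
have dl1 : dl <= 1 by rewrite ge_min lexx.
have dlD : m%:R * dl * (2 * c + 2) <= gap / 2.
  have : dl <= gap / D by rewrite ge_min lexx orbT.
  rewrite ler_pdivlMr // /D; lra.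
(* The window [lam - dl, lam + dl] then starts exactly at the required level [c]. *)
pose lam := c + dl; have lam0 : 0 < lam by rewrite addr_gt0.
pose kappa := gap / 4; have k0 : 0 < kappa by rewrite divr_gt0.
have hkap : kappa - ln 2 + lam ^+ 2 * m%:R / 2 + lam * m%:R * dl <= - kappa.
  have h1 : m%:R * c ^+ 2 = 2 * (ln 2 - gap) by rewrite c2 /gap; ring.
  have h2 : m%:R * dl * (3 / 2 * dl) <= m%:R * dl * 2.
    by rewrite ler_wpM2l ?mulr_ge0 ?ltW //; lra.
  by move: h1 h2 dlD; rewrite /lam /kappa; lra.
have [th [eps [th0 eps0 eps1 hk]]] := near_count_exponent k0.
pose L := lam ^+ 2 * m%:R ^+ 2.
have L0 : 0 <= L by rewrite mulr_ge0 ?sqr_ge0.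
have [|||p1 Hp1] := @far_exponent_bound R L (1 - eps); [by []|lra|lra|].
have e0 : 0 < dl / 4 / (lam * m%:R) by rewrite !divr_gt0 // mulr_gt0.
have [p2 Hp2] := expr_lt_eventually xi0 xi1 e0.
have [n1 Hn1] := @exists_masks_itv R m xi eta eta0 ex xi1.
(* [p1] serves the far pairs, [p2] makes the drift lam m xi^p at most dl / 4. *)
exists (p1 + p2)%N => p p2' pp.
pose E n := [set w | S_pspin (fun i => J n p i w) gamma m xi eta !=set0].
have mE n : measurable (E n) by exact: measurable_S_pspin.
suff cvgC : P n p (~` E n) @[n --> \oo] --> 0%E.
  rewrite (_ : (fun n => _) = fun n => (1 - P n p (~` E n))%E); last first.
    apply/funext => n; rewrite -probability_setC ?setCK //.
    exact: measurableC.
  rewrite -[X in _ --> X]sube0; apply: cvgeB => //; exact: cvg_cst.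
(* One constant for each error term of [not_prob_S_pspin_le]; the 4 in [K3] comes from (n + 1)^2 <=
   4 n^2. *)
pose K1 := 4 * m%:R * (1 + (dl ^+ 2 / 4)^-1); pose K2 := 4 * L.
pose K3 : R := 4 * 64 ^+ 4 * m%:R ^+ 2.
pose K4 := 2 * m%:R ^+ 2 * (1 + kappa^-1).
apply: (@cvge0_le_harmonic _ _ (K1 + K2 + K3 + K4) (n1 + (Num.truncn (2 * L)).+1)%N) => n.
  exact: measure_ge0.
move=> Nn; have n1n : (n1 <= n)%N by apply: leq_trans Nn; rewrite leq_addr.
have tn : ((Num.truncn (2 * L)).+1 <= n)%N by apply: leq_trans Nn; rewrite leq_addl.
have n0 : (0 < n)%N by exact: leq_trans tn.
have Ln : 2 * L <= n%:R.
  by apply: le_trans (ltW (truncnS_gt _)) _; rewrite ler_nat.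
have n0R : 1 <= n%:R :> R by rewrite ler1n.
have [a Ha] := Hn1 n n1n n0.
pose a' : {ffun 'I_m -> {ffun 'I_n -> bool}} := [ffun t => a t].
have ova : overlaps_in xi eta a'.
  apply/forallP => t; apply/forallP => l; apply/implyP => tl.
  by rewrite !ffunE; apply: Ha; rewrite neq_ltn tl.
have lamxi : lam * (m%:R * xi ^+ p) <= dl / 4.
  have := ltW (Hp2 p (leq_trans (leq_addl _ _) pp)).
  by rewrite ler_pdivlMr ?mulr_gt0 //; lra.
have M0 : 0 <= 64 ^+ 4 / n%:R ^+ 2 :> R by rewrite divr_ge0 ?exprn_ge0.
have hfar (x : R) : `|x| <= 1 - eps -> _ :=
  Hp1 p n x (leq_trans (leq_addr _ _) pp) n0.
rewrite -[leLHS]fineK; last by rewrite fin_num_measure //; exact: measurableC.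
rewrite lee_fin.
have clam : gamma * Num.sqrt (2 * ln 2) + dl <= lam by [].
apply: le_trans (not_prob_S_pspin_le (iidJ n p p2') n0 m0 xi0 ex th0 hk ova dl0
  clam lam0 lamxi M0 hfar hkap) _.
have S0 : 0 < n.+1%:R :> R by rewrite ltr0n.
have dl2 : 0 < dl ^+ 2 / 4 by rewrite divr_gt0 // exprn_gt0.
rewrite (mulrDl _ K4) (mulrDl _ K3) (mulrDl _ K2); apply: lerD; [apply: lerD;
  [apply: lerD|]|].
- rewrite -[leRHS]mulrA; apply: ler_wpM2l; first by rewrite mulr_ge0.
  exact: expRN_le_harmonic.
- exact: expR_sub1_le_harmonic.
- rewrite /K3 ler_pdivlMr // -[n.+1%:R]natr1.
  have -> : 64 ^+ 4 / n%:R ^+ 2 * (m%:R ^+ 2 * (n%:R + 1)) * (n%:R + 1) =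
    64 ^+ 4 * m%:R ^+ 2 * ((n%:R + 1) ^+ 2 / n%:R ^+ 2) :> R by ring.
  rewrite -[4 * _ * _]mulrA [leRHS]mulrC ler_wpM2l ?mulr_ge0 ?exprn_ge0 //.
  have n2 : 0 < n%:R ^+ 2 :> R by rewrite exprn_gt0 // ltr0n.
  by rewrite ler_pdivrMr //; nra.
- rewrite -[leRHS]mulrA; apply: ler_wpM2l; first by rewrite mulr_ge0 ?sqr_ge0.
  exact: expRN_le_harmonic.
Qed.

(** Disjointness of [A] and [B] makes [c] a bound for both sets; midpoints between [c] and a wrong
    supremum or infimum show that it is sharp. *)
Lemma sup_inf_threshold (R : realType) (A B : R -> Prop) (c : R) : 0 < c ->
  (forall x, 0 < x -> x < c -> A x) -> (forall x, c < x -> B x) ->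
  (forall x, A x -> ~ B x) ->
  sup [set x | 0 < x /\ A x] = c /\ c = inf [set x | 0 < x /\ B x].
Proof.
move=> c0 lA gB AB.
have ubA : ubound [set x | 0 < x /\ A x] c.
  by move=> x [_ Ax]; rewrite leNgt; apply/negP => /gB; exact: AB.
have lbB : lbound [set x | 0 < x /\ B x] c.
  by move=> x [x0 Bx]; rewrite leNgt; apply/negP => /(lA _ x0) /AB.
have Ah : [set x | 0 < x /\ A x] (c / 2) by split; [lra|apply: lA; lra].
have Bh : [set x | 0 < x /\ B x] (c + 1) by split; [lra|apply: gB; lra].
split; apply/eqP; rewrite eq_le; apply/andP; split.
- by apply: ge_sup => //; exists (c / 2).
- rewrite leNgt; apply/negP => sc.
  have hs : c / 2 <= sup [set x | 0 < x /\ A x].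
    by apply: ub_le_sup => //; exists c.
  have : (sup [set x | 0 < x /\ A x] + c) / 2 <= sup [set x | 0 < x /\ A x].
    apply: ub_le_sup; first by exists c.
    by split; [lra|apply: lA; lra].
  lra.
- by apply: lb_le_inf => //; exists (c + 1).
- rewrite leNgt; apply/negP => sc.
  have : inf [set x | 0 < x /\ B x] <= (inf [set x | 0 < x /\ B x] + c) / 2.
    apply: ge_inf; first by exists c.
    by split; [lra|apply: gB; lra].
  lra.
Qed.

Theorem theorem2p6 (R : realType) (d : nat -> nat -> measure_display)
    (T : forall n p : nat, measurableType (d n p))
    (P : forall n p : nat, probability (T n p) R)
    (J : forall n p : nat, {ffun 'I_p -> 'I_n} -> {RV (P n p) >-> R})
    (iidJ : forall n p : nat, (2 <= p)%N -> iid_standard_gaussian (@J n p))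
    (m : nat) (m_gt0 : (0 < m)%N) :
  sup [set gamma : R | 0 < gamma /\ admissible J m gamma]
    = 1 / Num.sqrt (m%:R : R) /\
  1 / Num.sqrt (m%:R : R)
    = inf [set gamma : R | 0 < gamma /\ inadmissible J m gamma].
Proof.
have s0 : 0 < Num.sqrt (m%:R : R) by rewrite sqrtr_gt0 ltr0n.
have mE (x : R) : m%:R * x ^+ 2 = (x * Num.sqrt (m%:R : R)) ^+ 2.
  by rewrite exprMn sqr_sqrtr ?ler0n // mulrC.
apply: sup_inf_threshold => [|x x0|x|x Ax [xi [eta [[eta0 ex xi1] [p1 Hin]]]]].
- by rewrite divr_gt0.
- rewrite ltr_pdivlMr // => x1; apply: admissible_lt => //.
  by rewrite mE exprn_ilt1 // ltW // mulr_gt0.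
- move=> cx; have x0 : 0 < x by apply: lt_trans cx; rewrite divr_gt0.
  move: cx; rewrite ltr_pdivrMr // => x1; apply: inadmissible_gt => //.
  by rewrite mE exprn_egt1.
- have [p0 Had] := Ax xi eta eta0 ex xi1.
  pose p := (2 + p0 + p1)%N.
  have p2 : (2 <= p)%N by rewrite /p -addnA leq_addr.
  have h0 : (p0 <= p)%N by rewrite /p addnAC leq_addl.
  have h1 : (p1 <= p)%N by rewrite /p leq_addl.
  have e10 : 1%E = 0%E :> \bar R.
    exact: (cvg_unique (@ereal_hausdorff R) (Had p p2 h0) (Hin p p2 h1)).
  by have := oner_neq0 R; case: e10 => ->; rewrite eqxx.
Qed.
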